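(* Let $M\subset\mathbb{C}^2$ be a quadratic cone with hermitian signature $(\pi,\nu)$, $\pi\ge\nu$. Then there is a unique normal form $\rho$ in the list below such that $M$ is biholomorphic to $\{\rho=0\}$. More precisely, there is a unique type in the list, among the types listed under the hermitian signature $(\pi,\nu)$ of $M$, and a unique choice of parameters in the range given for that type, such that the germ of $M$ at the origin is biholomorphic to the germ at the origin of $\{\rho=0\}$, where $\rho$ is the defining function listed for this type with these parameters. Signature $(2,0)$: - $\mathcal{M}_{(2,0)}$, parameters $0\le B\le A$, $A>1$: $\rho=\operatorname{Re}(Az_1^2+Bz_2^2)+|z_1|^2+|z_2|^2$. Signature $(1,1)$: - $\mathcal{M}_{(1,1)}^1$, parameters $0\le B\le A$: $\rho=\operatorname{Re}(Az_1^2+Bz_2^2)+|z_1|^2-|z_2|^2$. - $\mathcal{M}_{(1,1)}^2$, parameter $A\in\mathbb{C}$ with $\operatorname{Re}A>0$, $\operatorname{Im}A\ge0$: $\rho=\operatorname{Re}(Az_1^2+\overline{A}z_2^2)+\operatorname{Im}(z_1\overline{z_2})$. - $\mathcal{M}_{(1,1)}^3$, no parameters: $\rho=\operatorname{Re}(z_1^2)+\operatorname{Im}(z_1\overline{z_2})$. - $\mathcal{M}_{(1,1)}^4$, parameter $A>0$: $\rho=\operatorname{Re}(z_1^2+iAz_1z_2)+\operatorname{Im}(z_1\overline{z_2})$. Signature $(1,0)$: - $\mathcal{M}_{(1,0)}^1$, parameter $A\ge0$: $\rho=\operatorname{Re}(Az_1^2+z_2^2)+|z_1|^2$. - $\mathcal{M}_{(1,0)}^2$,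 no parameters: $\rho=\operatorname{Re}(z_1z_2)+|z_1|^2$. Signature $(0,0)$: - $\mathcal{M}_{(0,0)}^1$, no parameters: $\rho=\operatorname{Re}(z_1^2+z_2^2)$.
   Context: A (real) quadratic cone in $\mathbb{C}^n$, $n>1$, is an irreducible real algebraic set $M\subset\mathbb{C}^n$ of pure dimension $2n-1$ of the form $M=\{z\in\mathbb{C}^n:\rho(z)=0\}$, where $\rho$ is a real-valued homogeneous polynomial of degree two in $x_j,y_j$ ($z_j=x_j+iy_j$). Irreducible means that $M$ is not the union of two proper such subsets. The function $\rho$ is taken to be a defining function of $M$, i.e. $d\rho(z)\ne0$ for some $z\in M$ (equivalently, the real quadratic form $\rho$ has at least one positive and at least one negative eigenvalue). Such $\rho$ decomposes uniquely as $\rho(z)=\operatorname{Re}(z^{t}Sz)+\overline{z}^{t}Hz$ with $S$ a complex symmetric matrix and $H$ a hermitian matrix. The hermitian signature of $M$ is $(\pi,\nu)$, where $\pi$ (resp. $\nu$) is the number of positive (resp. negative) eigenvalues of $H$. Since $\rho$ and $-\rho$ define the same cone, the sign of $\rho$ is chosen so that $\pi\ge\nu$. Two germs $M,M'$ at $0$ are biholomorphic if there is a germ of biholomorphism $F:(\mathbb{C}^2,0)\to(\mathbb{C}^2,0)$ with $F(M)=M'$. *)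

(* Defs.v *)
From HB Require Import structures.
From mathcomp Require Import all_boot all_order all_algebra.
From mathcomp Require Import complex.
From mathcomp Require Import boolp classical_sets reals topology normedtype.
From mathcomp Require Import derive.
(* The notations of mpoly clash with those of the topology files. *)
From mathcomp Require mpoly.
Import -(notations) mpoly.

Set Implicit Arguments.
Unset Strict Implicit.
Unset Printing Implicit Defensive.
Import Order.TTheory GRing.Theory Num.Theory.
Import numFieldNormedType.Exports.

Local Open Scope classical_set_scope.
Local Open Scope ring_scope.
Local Open Scope complex_scope.

(* R[i] is a numClosedFieldType; these instances give the concrete type R[i]
   the norm topology, so that 'cV[R[i]]_n is a normed R[i]-module and
   [differentiable] is complex (Frechet) differentiability. *)
HB.instance Definition _ (R : rcfType) := PseudoPointedMetric.copy R[i] R[i]^o.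
HB.instance Definition _ (R : rcfType) := NormedModule.copy R[i] R[i]^o.

Notation Re := complex.Re.
Notation Im := complex.Im.

(* (x_1, ..., x_n, y_1, ..., y_n), where z_j = x_j + i y_j *)
Definition real_coords {R : realType} {n : nat} (z : 'cV[R[i]]_n)
    (k : 'I_(n + n)) : R :=
  match split k with
  | inl j => Re (z j 0)
  | inr j => Im (z j 0)
  end.

Definition real_eval {R : realType} {n : nat} (p : mpoly (n + n) R)
    (z : 'cV[R[i]]_n) : R :=
  meval (real_coords z) p.

Definition real_algebraic {R : realType} {n : nat} (X : set 'cV[R[i]]_n) :=
  exists ps : seq (mpoly (n + n) R),
    X = [set z | forall p, p \in ps -> real_eval p z = 0].

Definition irreducible_algebraic {R : realType} {n : nat}
    (X : set 'cV[R[i]]_n) :=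
  [/\ real_algebraic X, X !=set0
    & forall Y Z : set 'cV[R[i]]_n, real_algebraic Y -> real_algebraic Z ->
        X = Y `|` Z -> Y = X \/ Z = X].

(* The dimension of a real algebraic set is its Krull dimension: the largest d
   for which it contains a chain X_0 < X_1 < ... < X_d of irreducible real
   algebraic sets. *)
Definition krull_dim_ge {R : realType} {n : nat} (X : set 'cV[R[i]]_n)
    (d : nat) :=
  exists Y : nat -> set 'cV[R[i]]_n,
    (forall i, (i <= d)%N -> irreducible_algebraic (Y i) /\ Y i `<=` X) /\
    (forall i, (i < d)%N -> Y i `<` Y i.+1).

Definition zariski_closure {R : realType} {n : nat} (X : set 'cV[R[i]]_n) :
    set 'cV[R[i]]_n :=
  [set z | forall p : mpoly (n + n) R,
    (forall w, X w -> real_eval p w = 0) -> real_eval p z = 0].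

(* The local dimension of X at a is the minimum, over the neighbourhoods U of
   a, of the dimension of the Zariski closure of X `&` U. *)
Definition local_dim {R : realType} {n : nat} (X : set 'cV[R[i]]_n)
    (a : 'cV[R[i]]_n) (d : nat) :=
  (forall U, nbhs a U -> krull_dim_ge (zariski_closure (X `&` U)) d) /\
  (exists2 U, nbhs a U & ~ krull_dim_ge (zariski_closure (X `&` U)) d.+1).

Definition pure_dim {R : realType} {n : nat} (X : set 'cV[R[i]]_n) (d : nat) :=
  forall a, X a -> local_dim X a d.

Definition defining_function {R : realType} {n : nat}
    (rho : mpoly (n + n) R) (M : set 'cV[R[i]]_n) :=
  [/\ rho \is ishomog1 2 mdeg,
      M = [set z | real_eval rho z = 0]
    & exists z, M z /\ exists k, real_eval (mderiv k rho) z != 0].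

Definition quadratic_cone {R : realType} {n : nat} (M : set 'cV[R[i]]_n) :=
  [/\ irreducible_algebraic M, pure_dim M (n + n).-1
    & exists rho, defining_function rho M].

(* rho(z) = Re (z^t S z) + conj(z)^t H z *)
Definition hermitian_decomposition {R : realType} {n : nat}
    (rho : mpoly (n + n) R) (S H : 'M[R[i]]_n) :=
  [/\ S \is symmetricmx, H \is hermsymmx
    & forall z : 'cV[R[i]]_n,
        (real_eval rho z)%:C =
          (Re ((z^T *m S *m z) 0 0))%:C
          + ((map_mx Num.conj z)^T *m H *m z) 0 0].

(* [spectral_diag H] lists the eigenvalues of the hermitian matrix H with
   multiplicity. *)
Definition num_pos_eigenvalues {R : realType} {n : nat} (H : 'M[R[i]]_n) :=
  #|[pred i | 0 < spectral_diag H 0 i]|.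

Definition num_neg_eigenvalues {R : realType} {n : nat} (H : 'M[R[i]]_n) :=
  #|[pred i | spectral_diag H 0 i < 0]|.

(* Both rho and - rho define M; [nu <= pi] fixes the sign. *)
Definition hermitian_signature {R : realType} {n : nat}
    (M : set 'cV[R[i]]_n) (pi nu : nat) :=
  (exists (rho : mpoly (n + n) R) (S H : 'M[R[i]]_n),
    [/\ defining_function rho M, hermitian_decomposition rho S H,
        pi = num_pos_eigenvalues H & nu = num_neg_eigenvalues H])
  /\ (nu <= pi)%N.

Definition holomorphic_on {R : realType} {m n : nat} (U : set 'cV[R[i]]_m)
    (F : 'cV[R[i]]_m -> 'cV[R[i]]_n) :=
  forall z, U z -> differentiable F z.

(* F restricts to a biholomorphism from U onto V that fixes 0 and maps the
   germ of M at 0 onto the germ of M' at 0. *)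
Definition germ_biholomorphic {R : realType} {n : nat}
    (M M' : set 'cV[R[i]]_n) :=
  exists (U V : set 'cV[R[i]]_n) (F G : 'cV[R[i]]_n -> 'cV[R[i]]_n),
    [/\ [/\ open U, open V, U 0 & F 0 = 0],
        [/\ holomorphic_on U F, holomorphic_on V G, F @` U = V
          & forall z, U z -> G (F z) = z]
      & F @` (M `&` U) = M' `&` V].

(* NFpn_k is the k-th type listed under the hermitian signature (p, n). *)
Variant normal_form (R : realType) :=
  | NF20 of R & R
  | NF11_1 of R & R
  | NF11_2 of R[i]
  | NF11_3
  | NF11_4 of R
  | NF10_1 of R
  | NF10_2
  | NF00_1.

Arguments NF11_3 {R}.
Arguments NF10_2 {R}.
Arguments NF00_1 {R}.

Definition nf_signature {R : realType} (t : normal_form R) : nat * nat :=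
  match t with
  | NF20 _ _ => (2, 0)
  | NF11_1 _ _ | NF11_2 _ | NF11_3 | NF11_4 _ => (1, 1)
  | NF10_1 _ | NF10_2 => (1, 0)
  | NF00_1 => (0, 0)
  end%N.

Definition nf_in_range {R : realType} (t : normal_form R) : Prop :=
  match t with
  | NF20 A B => [/\ 0 <= B, B <= A & 1 < A]
  | NF11_1 A B => 0 <= B /\ B <= A
  | NF11_2 A => 0 < Re A /\ 0 <= Im A
  | NF11_4 A => 0 < A
  | NF10_1 A => 0 <= A
  | NF11_3 | NF10_2 | NF00_1 => True
  end.

Definition sqnorm {R : realType} (w : R[i]) : R := Re (`|w| ^+ 2).

Definition nf_rho {R : realType} (t : normal_form R) (z : 'cV[R[i]]_2) : R :=
  let z1 := z 0 0 in
  let z2 := z 1 0 in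
  match t with
  | NF20 A B =>
      Re (A%:C * z1 ^+ 2 + B%:C * z2 ^+ 2) + sqnorm z1 + sqnorm z2
  | NF11_1 A B =>
      Re (A%:C * z1 ^+ 2 + B%:C * z2 ^+ 2) + sqnorm z1 - sqnorm z2
  | NF11_2 A =>
      Re (A * z1 ^+ 2 + Num.conj A * z2 ^+ 2) + Im (z1 * Num.conj z2)
  | NF11_3 => Re (z1 ^+ 2) + Im (z1 * Num.conj z2)
  | NF11_4 A =>
      Re (z1 ^+ 2 + 'i * A%:C * z1 * z2) + Im (z1 * Num.conj z2)
  | NF10_1 A => Re (A%:C * z1 ^+ 2 + z2 ^+ 2) + sqnorm z1
  | NF10_2 => Re (z1 * z2) + sqnorm z1
  | NF00_1 => Re (z1 ^+ 2 + z2 ^+ 2)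
  end.

Definition nf_zeros {R : realType} (t : normal_form R) : set 'cV[R[i]]_2 :=
  [set z | nf_rho t z = 0].

(* Main.v *)
Require Import Defs.
From mathcomp Require Import all_boot all_order all_algebra.
From mathcomp Require Import complex.
From mathcomp Require Import boolp classical_sets reals topology normedtype.
From mathcomp Require Import functions derive.
From mathcomp Require mpoly.
Import -(notations) mpoly.
From mathcomp Require Import ring lra.

(** A quadratic cone is the zero set of a real quadratic form on C^2, which is
    a pair (S, H) of a symmetric and a hermitian matrix, acting by
    Re (z^t S z) + z^* H z.  A C-linear change of variables P turns (S, H) into
    (P^t S P, P^* H P); together with real rescaling this is the relation
    [congruent].  The theorem reduces to the classification of pairs up to
    congruence.

    From germs to pairs.  A biholomorphic germ F fixing 0 and mapping M to M'
    has an invertible derivative L at 0.  Both cones are invariant under real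
    dilations and closed, so F (h v) / h -> L v gives L M `<=` M'
    ([tangent_cone]).  The form defining M takes both signs, because it has a
    nonzero derivative at one of its zeros ([derivative_indefinite]), and a
    form which takes both signs is determined up to a factor by its zeros: on
    a line through a point of each sign it has two distinct zeros, at which
    the other form must vanish too ([zero_set_proportional]).  Hence the pair
    of M and that of M' are congruent ([germ_congruent]).  Conversely, linear
    maps are biholomorphic ([congruent_germ]).

    Existence.  When H is invertible, the formula h(x, T y) = conj (s(x, y)),
    where h and s are the sesquilinear and bilinear forms of H and S, defines
    an antilinear operator T.  Its square is linear, so it has an eigenvalue l.
    If l is not in [0, +oo[ there is an isotropic eigenvector x of T^2, and in
    the basis (x, T x) the pair is of the second type of signature (1,1).
    Otherwise T has an eigenvector w with eigenvalue sqrt l; if w is not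
    isotropic its orthogonal complement splits the pair into a diagonal one,
    and if it is isotropic a shear and a scaling lead to the remaining types
    ([nondegenerate_trichotomy], [congruent_isotropic]).  When H is singular
    one completes squares in S; here the pairs involving a single variable
    have to be excluded, and they are, since such an indefinite form is a
    product of two real linear forms, so that its zero set is a reducible
    union of two hyperplanes ([split_reducible]).

    Uniqueness.  Congruence preserves the sign of det H and the vanishing of
    H, which separate the signatures.  When H is invertible, the matrix of T^2
    changes by a conjugation only, so its trace, its determinant and the
    property of being scalar are invariants, as is the vanishing of S; these
    separate all types and parameters ([nf_congruent_uniq]).  For signature
    (1,0) the matrix P is triangular and the comparison is direct
    ([congruent_rank1]). *)

Set Implicit Arguments.
Unset Strict Implicit.
Unset Printing Implicit Defensive.
Import Order.TTheory GRing.Theory Num.Theory.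
Import numFieldNormedType.Exports.
Local Open Scope classical_set_scope.
Local Open Scope ring_scope.
Local Open Scope sesquilinear_scope.

(** * Two by two matrices *)

Section Mat2.
Variable (K : comNzRingType).
Implicit Types (a b c d : K) (A : 'M[K]_2) (v : 'cV[K]_2).

Definition mat2 a b c d : 'M[K]_2 :=
  \matrix_(i, j) if i == 0 then if j == 0 then a else b
                 else if j == 0 then c else d.

Definition vec2 a b : 'cV[K]_2 := \col_i if i == 0 then a else b.

Lemma mat2_eta A : A = mat2 (A 0 0) (A 0 1) (A 1 0) (A 1 1).
Proof.
apply/matrixP => i j; rewrite mxE.
by case: (unliftP ord0 i) => [i'|] ->; rewrite ?ord1;
  case: (unliftP ord0 j) => [j'|] ->; rewrite ?ord1 //=; congr (A _ _); apply: val_inj.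
Qed.

Lemma vec2_eta v : v = vec2 (v 0 0) (v 1 0).
Proof.
apply/matrixP => i j; rewrite mxE ord1.
by case: (unliftP ord0 i) => [i'|] ->; rewrite ?ord1 //=; congr (v _ _); apply: val_inj.
Qed.

Lemma mat2_mul a b c d a' b' c' d' :
  mat2 a b c d *m mat2 a' b' c' d' =
  mat2 (a * a' + b * c') (a * b' + b * d') (c * a' + d * c') (c * b' + d * d').
Proof. by rewrite [LHS]mat2_eta !mxE !big_ord_recl !big_ord0 !mxE /= !addr0. Qed.

Lemma mat2_vec a b c d x y :
  mat2 a b c d *m vec2 x y = vec2 (a * x + b * y) (c * x + d * y).
Proof. by rewrite [LHS]vec2_eta !mxE !big_ord_recl !big_ord0 !mxE /= !addr0. Qed.

Lemma mat2_tr a b c d : (mat2 a b c d)^T = mat2 a c b d.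
Proof. by rewrite [LHS]mat2_eta !mxE. Qed.

Lemma mat2_scale k a b c d :
  k *: mat2 a b c d = mat2 (k * a) (k * b) (k * c) (k * d).
Proof. by rewrite [LHS]mat2_eta !mxE. Qed.

Lemma mat2_det a b c d : \det (mat2 a b c d) = a * d - b * c.
Proof.
rewrite (expand_det_row _ 0) !big_ord_recl big_ord0 /cofactor !det_mx11 !mxE /=.
by rewrite expr0 expr1; ring.
Qed.

Lemma mat2_trace a b c d : \tr (mat2 a b c d) = a + d.
Proof. by rewrite /mxtrace !big_ord_recl big_ord0 !mxE /= addr0. Qed.

Lemma mat2_1 : 1%:M = mat2 1 0 0 1.
Proof. by rewrite [LHS]mat2_eta !mxE. Qed.

Lemma mat2_inj a b c d a' b' c' d' :
  mat2 a b c d = mat2 a' b' c' d' -> [/\ a = a', b = b', c = c' & d = d'].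
Proof.
move=> /matrixP e; split; [have := e 0 0 | have := e 0 1 | have := e 1 0 | have := e 1 1];
  by rewrite !mxE.
Qed.

End Mat2.

Arguments vec2_eta {K} v.
Arguments mat2_eta {K} A.

(** * Congruence of pairs of forms *)

Section Congruence.
Variable (C : numClosedFieldType).
Implicit Types (S H P : 'M[C]_2) (v w x y : 'cV[C]_2).

Lemma mat2_conj (a b c d : C) :
  (mat2 a b c d) ^t* = mat2 a^* c^* b^* d^*.
Proof. by rewrite [LHS]mat2_eta !mxE. Qed.

Lemma mat2_map_conj (a b c d : C) :
  map_mx Num.conj (mat2 a b c d) = mat2 a^* b^* c^* d^*.
Proof. by rewrite [LHS]mat2_eta !mxE. Qed.

(** The factor c may be negative: a form and its opposite have the same zeros. *)
Definition congruent S H S' H' :=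
  exists P (c : C), [/\ P \in unitmx, c \is Num.real, c != 0,
    P^T *m S *m P = c *: S' & P ^t* *m H *m P = c *: H'].

Lemma congruent_trans S H S' H' S'' H'' :
  congruent S H S' H' -> congruent S' H' S'' H'' -> congruent S H S'' H''.
Proof.
move=> [P [c [Pu cr c0 eS eH]]] [Q [d [Qu dr d0 fS fH]]].
exists (P *m Q), (c * d); split.
- by rewrite unitmx_mul Pu.
- exact: realM.
- by rewrite mulf_neq0.
- rewrite trmx_mul -!mulmxA (mulmxA S) (mulmxA P^T) (mulmxA P^T) eS -scalemxAl -scalemxAr.
  by rewrite (mulmxA Q^T) fS scalerA.
- rewrite trmx_mul map_mxM -!mulmxA (mulmxA H) (mulmxA (P ^t*)) (mulmxA (P ^t*)) eH.
  by rewrite -scalemxAl -scalemxAr (mulmxA (Q ^t*)) fH scalerA.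
Qed.

Lemma congruent_sym S H S' H' : congruent S H S' H' -> congruent S' H' S H.
Proof.
move=> [P [c [Pu cr c0 eS eH]]].
have trP : (invmx P)^T *m P^T = 1%:M by rewrite -trmx_mul mulmxV ?trmx1.
have tcP : (invmx P) ^t* *m P ^t* = 1%:M by rewrite -map_mxM trP map_mx1.
exists (invmx P), c^-1; split.
- by rewrite unitmx_inv.
- by rewrite realV.
- by rewrite invr_eq0.
- have <- : c^-1 *: (P^T *m S *m P) = S' by rewrite eS scalerA mulVf // scale1r.
  rewrite -scalemxAr -scalemxAl !mulmxA trP mul1mx -!mulmxA mulmxV // mulmx1 //.
- have <- : c^-1 *: (P ^t* *m H *m P) = H' by rewrite eH scalerA mulVf // scale1r.
  rewrite -scalemxAr -scalemxAl !mulmxA tcP mul1mx -!mulmxA mulmxV // mulmx1 //.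
Qed.

(** The form in which concrete congruences are checked: the entries of the two
    transformed matrices, for the change of variables with rows (p, q), (r, s).
    The lower left entry of the target has a name of its own so that it
    unifies with syntactically different spellings of the upper right one. *)
Lemma congruent_mat2 (p q r s c a b d k l m n a' b' b1' d' k' l' m' n' : C) :
  p * s - q * r != 0 -> c \is Num.real -> c != 0 ->
  a * p ^+ 2 + b * p * r *+ 2 + d * r ^+ 2 = c * a' ->
  a * p * q + b * (p * s + q * r) + d * r * s = c * b' ->
  b1' = b' ->
  a * q ^+ 2 + b * q * s *+ 2 + d * s ^+ 2 = c * d' ->
  p^* * (k * p + l * r) + r^* * (m * p + n * r) = c * k' ->
  p^* * (k * q + l * s) + r^* * (m * q + n * s) = c * l' ->
  q^* * (k * p + l * r) + s^* * (m * p + n * r) = c * m' ->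
  q^* * (k * q + l * s) + s^* * (m * q + n * s) = c * n' ->
  congruent (mat2 a b b d) (mat2 k l m n) (mat2 a' b' b1' d') (mat2 k' l' m' n').
Proof.
move=> det cr c0 e1 e2 -> e3 f1 f2 f3 f4; exists (mat2 p q r s), c; split=> //.
- by rewrite unitmxE mat2_det unitfE.
- rewrite mat2_tr !mat2_mul mat2_scale -e1 -e2 -e3; congr mat2; ring.
- rewrite mat2_conj !mat2_mul mat2_scale -f1 -f2 -f3 -f4; congr mat2; ring.
Qed.

End Congruence.

(** * Reduction of explicit pairs *)

Section Normalise.
Variable (C : numClosedFieldType).

(** The coefficient of the square of a variable is made nonnegative by rotating
    the variable, which leaves its modulus free to be prescribed. *)
Lemma exists_phase (z m : C) : 0 <= m ->
  exists u, u^* * u = m /\ 0 <= u ^+ 2 * z.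
Proof.
move=> m0; have [->|z0] := eqVneq z 0.
  exists (sqrtC m); rewrite mulr0 lexx; split=> //.
  by rewrite geC0_conj ?sqrtC_ge0 // -expr2 sqrtCK.
have nz : `|z| != 0 by rewrite normr_eq0.
exists (sqrtC (m * (`|z| / z))); split; last first.
  by rewrite sqrtCK -mulrA divfK // mulr_ge0.
rewrite mulrC -normCK -normrX sqrtCK normrM normf_div normr_id divff // mulr1.
exact: ger0_norm.
Qed.

(** Rotations make the diagonal entries of S nonnegative and scalings make those
    of H units.  Exchanging the variables then orders the entries of S.  For e = -1 this
    changes the sign of H; an additional factor i in the variables changes that of
    S as well, and the factor c = -1 restores both. *)
Lemma congruent_diag (a d p r : C) :
  p \is Num.real -> r \is Num.real -> p != 0 -> r != 0 ->
  exists A B e, [/\ 0 <= B, B <= A, e = Num.sg (p * r) &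
   congruent (mat2 a 0 0 d) (mat2 p 0 0 r) (mat2 A 0 0 B) (mat2 1 0 0 e)].
Proof.
move=> pr rr p0 r0; set e := Num.sg (p * r).
have e2 : e * e = 1 by rewrite /e -expr2 sqr_sg mulf_neq0.
have [eE ep] : (e = 1 \/ e = -1) /\ 0 <= e * (p * r).
  rewrite /e; case: (real_ltgtP (real0 C) (realM pr rr)) => h.
  - by rewrite gtr0_sg // mul1r ltW //; split=> //; left.
  - by rewrite ltr0_sg // mulN1r oppr_ge0 ltW //; split=> //; right.
  - by move/eqP: h; rewrite eq_sym mulf_eq0 (negPf p0) (negPf r0).
have m0 : 0 <= e * p / r.
  have -> : e * p / r = e * (p * r) / r ^+ 2 by field.
  by apply: divr_ge0; last by rewrite real_exprn_even_ge0.
have [u [u1 u2]] := exists_phase (a / p) ler01.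
have [v [v1 v2]] := exists_phase (d / p) m0.
set A := u ^+ 2 * (a / p) in u2; set B := v ^+ 2 * (d / p) in v2.
have c1 : congruent (mat2 a 0 0 d) (mat2 p 0 0 r) (mat2 A 0 0 B) (mat2 1 0 0 e).
  apply: (@congruent_mat2 _ u 0 0 v p); rewrite ?rmorph0 //; try (by ring).
  - rewrite mulr0 subr0 mulf_neq0 //; apply/eqP => z; move: u1 v1; rewrite z mulr0 => /eqP.
      by rewrite eq_sym oner_eq0.
    move=> _ /esym/eqP; rewrite !mulf_eq0 invr_eq0 (negPf p0) (negPf r0) !orbF.
    by case: eE => ->; rewrite ?oppr_eq0 oner_eq0.
  - by rewrite /A; field.
  - by rewrite /B; field.
  - rewrite mul0r addr0 mul0r addr0 mulrCA u1; ring.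
  - transitivity (r * (v^* * v)); first by ring.
    by rewrite v1; field.
have [AB|BA] := real_leP (ger0_real v2) (ger0_real u2).
  by exists A, B, e.
exists B, A, e; split => //; first exact: ltW.
apply: congruent_trans c1 _.
case: eE => ->.
  apply: (@congruent_mat2 _ 0 1 1 0 1); rewrite ?rmorph0 ?rmorph1 ?oner_eq0 ?real1 //;
      try (by ring).
  by rewrite !mul1r mul0r sub0r oppr_eq0 oner_eq0.
have i2 := @sqrCi C.
apply: (@congruent_mat2 _ 0 'i 'i 0 (-1)); rewrite ?rmorph0 ?conjCi ?oppr_eq0 ?oner_eq0
    ?realN ?real1 //; try (by ring); try by ring: i2.
by rewrite mul0r -expr2 sqrCi sub0r opprK oner_eq0.
Qed.

(** Scaling both variables; here - 4 A^2 is the eigenvalue of the square of the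
    antilinear operator of the pair, which fixes A up to sign. *)
Lemma congruent_antidiag (A k : C) : k != 0 -> A != 0 ->
  congruent (mat2 k^* 0 0 (- 4 * A^* ^+ 2 * k)) (mat2 0 k k^* 0)
            (mat2 A 0 0 A^*) (mat2 0 ('i / 2) (- 'i / 2) 0).
Proof.
move=> k0 A0; have i2 := @sqrCi C; have i0 := neq0Ci C.
(* With the variables scaled by 2 i A conj(t) and t, the entry k becomes
   - 2 i A^* t^2 k, and it has to be i / 2. *)
have [t t2] : exists t : C, 4 * (t ^+ 2 * A^* * k) = -1.
  exists (sqrtC (- (4 * (A^* * k))^-1)); rewrite sqrtCK.
  by field; rewrite conjC_eq0 A0 k0.
have ct2 : 4 * (t^* ^+ 2 * A * k^*) = -1.
  have /(congr1 Num.conj) := t2.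
  by rewrite !rmorphM /= rmorph_nat conjCK rmorphN rmorph1.
have t0 : t != 0.
  by apply/eqP => z; move: t2 => /eqP; rewrite z expr0n /= !mul0r mulr0 eq_sym oppr_eq0 oner_eq0.
apply: (@congruent_mat2 _ (t^* * (2 * 'i * A)) 0 0 t 1);
  rewrite ?rmorph0 ?oner_eq0 ?real1 //; try (by ring).
- by rewrite mulr0 subr0 !mulf_neq0 ?conjC_eq0 ?pnatr_eq0.
- transitivity (A * ((4 * (t^* ^+ 2 * A * k^*)) * 'i ^+ 2)); first by ring.
  by rewrite ct2 i2; ring.
- transitivity (- A^* * (4 * (t ^+ 2 * A^* * k))); first by ring.
  by rewrite t2; ring.
- rewrite !rmorphM /= conjCK conjCi rmorph_nat.
  transitivity (- 'i / 2 * (4 * (t ^+ 2 * A^* * k))); first by field.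
  by rewrite t2; ring.
- transitivity ( 'i / 2 * (4 * (t^* ^+ 2 * A * k^*))); first by field.
  by rewrite ct2; ring.
Qed.

Lemma congruent_antidiag_conj (A : C) :
  congruent (mat2 A 0 0 A^*) (mat2 0 ('i / 2) (- 'i / 2) 0)
            (mat2 A^* 0 0 A) (mat2 0 ('i / 2) (- 'i / 2) 0).
Proof.
apply: (@congruent_mat2 _ 0 (-1) 1 0 1); 
  rewrite ?rmorphN ?rmorph0 ?rmorph1 ?oner_eq0 ?real1 //; try (by field).
by rewrite mul0r mulr1 sub0r opprK oner_eq0.
Qed.

(** The second basis vector is isotropic for both forms.  Once H has
    the shape of the normal forms, adding to the first vector a real multiple of
    the second does not change H and, if s <> 0, can make t real; then a scaling,
    with c = -1 when t < 0, makes it 0 or 1.  If s = 0, a complex scaling of both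
    vectors makes t equal to 0 or 1. *)
Lemma congruent_isotropic (t s : C) : 0 <= s ->
  let S := mat2 t s s 0 in let H := mat2 0 1 1 0 in
  [\/ exists A, 0 <= A /\ congruent S H (mat2 A 0 0 A) (mat2 1 0 0 (-1)),
   congruent S H (mat2 1 0 0 0) (mat2 0 ('i / 2) (- 'i / 2) 0) |
   exists A, 0 < A /\ congruent S H (mat2 1 ('i * A / 2) ('i * A / 2) 0)
                                   (mat2 0 ('i / 2) (- 'i / 2) 0)].
Proof.
move=> s0 S H; have i2 := @sqrCi C; have i0 := neq0Ci C.
pose Hi : 'M[C]_2 := mat2 0 ('i / 2) (- 'i / 2) 0.
have two0 : 2 != 0 :> C by rewrite pnatr_eq0.
(* Bring H to the shape it has in the normal forms. *)
have c0 : congruent S H (mat2 t ('i * s / 2) ('i * s / 2) 0) Hi.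
  apply: (@congruent_mat2 _ 1 0 0 ('i / 2) 1);
    rewrite ?rmorph0 ?rmorph1 ?oner_eq0 ?real1 //; try (by field).
    by rewrite mul1r mulr0 subr0 mulf_neq0 ?invr_eq0.
  by rewrite rmorphM /= conjCi fmorphV rmorph_nat; field.
(* For t = 0 the substitution z1 = w1 + i w2, z2 = - i w1 - w2 diagonalises. *)
have cdiag : congruent (mat2 0 ('i * s / 2) ('i * s / 2) 0) Hi
                       (mat2 s 0 0 s) (mat2 1 0 0 (-1)).
  apply: (@congruent_mat2 _ 1 'i (-'i) (-1) 1);
    rewrite ?rmorphN ?rmorphN ?rmorph1 /= ?conjCi ?opprK ?oner_eq0 ?real1 //;
    try (by field: i2).
  have -> : 1 * -1 - 'i * - 'i = -2 :> C by ring: i2.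
  by rewrite oppr_eq0.
have [sz|sn0] := eqVneq s 0.
  have [tz|tn] := eqVneq t 0.
    constructor 1; exists s; split=> //; apply: congruent_trans c0 _.
    by rewrite tz.
  constructor 2; apply: congruent_trans c0 _; rewrite sz.
  pose q := sqrtC t.
  have q2 : q ^+ 2 = t by rewrite sqrtCK.
  have q0 : q != 0 by rewrite sqrtC_eq0.
  have qc0 : q^* != 0 by rewrite conjC_eq0.
  apply: (@congruent_mat2 _ q^-1 0 0 q^* 1);
    rewrite ?fmorphV /= ?conjCK ?rmorph0 ?oner_eq0 ?real1 //; try (by field).
  - by rewrite mulr0 subr0 mulf_neq0 ?invr_eq0.
  - by rewrite -q2; field.
  - by rewrite !(mul0r, mulr0, addr0).
have sgt : 0 < s by rewrite lt0r sn0.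
have sc : s^* = s by apply: geC0_conj.
have c1 : congruent S H (mat2 ('Re t) ('i * s / 2) ('i * s / 2) 0) Hi.
  apply: congruent_trans c0 _.
  have rc : (- 'Im t / s)^* = - 'Im t / s.
    by rewrite rmorphM rmorphN fmorphV /= sc (CrealP (Creal_Im t)).
  apply: (@congruent_mat2 _ 1 0 (- 'Im t / s) 1 1);
    rewrite ?rc ?rmorph0 ?rmorph1 ?oner_eq0 ?real1 //; try (by field).
  - by rewrite mul1r mul0r subr0 oner_eq0.
  - by rewrite [X in X * _]Crect; field.
have [t0|t0|t0] := real_ltgtP (real0 C) (Creal_Re t).
- constructor 3; exists s; split=> //; apply: congruent_trans c1 _.
  set x := 'Re t in t0 *; pose q := sqrtC x.
  have q2 : q ^+ 2 = x by rewrite sqrtCK.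
  have q0 : q != 0 by rewrite sqrtC_eq0 gt_eqF.
  have qc : q^* = q by rewrite geC0_conj // sqrtC_ge0 ltW.
  apply: (@congruent_mat2 _ q^-1 0 0 q 1);
    rewrite ?rmorph0 ?fmorphV /= ?qc ?oner_eq0 ?real1 //; try (by field).
  + by rewrite mulr0 subr0 mulf_neq0 ?invr_eq0.
  + by rewrite -q2; field.
- constructor 3; exists s; split=> //; apply: congruent_trans c1 _.
  set x := 'Re t in t0 *; pose q := sqrtC (- x).
  have q2 : x = - q ^+ 2 by rewrite sqrtCK opprK.
  have q0 : q != 0 by rewrite sqrtC_eq0 oppr_eq0 lt_eqF.
  have qc : q^* = q by rewrite geC0_conj // sqrtC_ge0 oppr_ge0 ltW.
  apply: (@congruent_mat2 _ q^-1 0 0 (- q) (-1));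
    rewrite ?rmorph0 ?rmorphN ?fmorphV /= ?qc ?oppr_eq0 ?oner_eq0 ?realN ?real1 //;
    try (by field).
  + by rewrite mulr0 subr0 mulf_neq0 ?invr_eq0 ?oppr_eq0.
  + by rewrite q2; field.
- constructor 1; exists s; split=> //; apply: congruent_trans c1 _.
  by rewrite -t0.
Qed.

End Normalise.

(** * The antilinear operator of a nondegenerate pair *)

Section Antilinear.
Variables (C : numClosedFieldType) (S H : 'M[C]_2).
Hypotheses (Ssym : S^T = S) (Hherm : H ^t* = H) (Hu : H \in unitmx).
Implicit Types (v w x y : 'cV[C]_2).

Definition hform x y := (x ^t* *m H *m y) 0 0.
Definition sform x y := (x^T *m S *m y) 0 0.
(** The operator T of [hform_antilin]: it represents the symmetric form s through
    the nondegenerate form h. *)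
Definition antilin y := invmx H *m map_mx Num.conj (S *m y).
Local Notation h := hform.
Local Notation s := sform.
Local Notation T := antilin.

Lemma hformC x y : (h x y)^* = h y x.
Proof.
have -> : (h x y)^* = ((x ^t* *m H *m y) ^t*) 0 0.
  by rewrite [RHS]mxE [X in _ = X^*]mxE.
by rewrite /h !trmx_mul !map_mxM /= trmxCK Hherm mulmxA.
Qed.

Lemma sformC x y : s x y = s y x.
Proof.
have -> : s x y = (x^T *m S *m y)^T 0 0 by rewrite mxE.
by rewrite !trmx_mul trmxK Ssym mulmxA.
Qed.

Lemma hformDr x y z a : h x (a *: y + z) = a * h x y + h x z.
Proof. by rewrite /h mulmxDr -scalemxAr !mxE. Qed.

Lemma hformDl x y z a : h (a *: y + z) x = a^* * h y x + h z x.
Proof. by rewrite -hformC hformDr rmorphD rmorphM /= !hformC. Qed.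

Lemma hformZr x y a : h x (a *: y) = a * h x y.
Proof. by rewrite /h -scalemxAr mxE. Qed.

Lemma hform_antilin x y : h x (T y) = (s x y)^*.
Proof.
rewrite /h /T mulmxA mulmxK //.
have -> : (s x y)^* = (map_mx Num.conj (x^T *m S *m y)) 0 0 by rewrite [RHS]mxE.
by rewrite -mulmxA [in RHS]map_mxM.
Qed.

Lemma hform_antilinC x y : h x (T y) = h y (T x).
Proof. by rewrite !hform_antilin sformC. Qed.

Lemma antilinD a x y : T (a *: x + y) = a^* *: T x + T y.
Proof.
by rewrite /T mulmxDr -scalemxAr map_mxD map_mxZ mulmxDr -scalemxAr.
Qed.

Lemma antilinZ a x : T (a *: x) = a^* *: T x.
Proof. by rewrite /T -scalemxAr map_mxZ -scalemxAr. Qed.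

(** The square of an antilinear operator is linear, so it has an eigenvalue. *)
Lemma antilin_eigen : exists l v, v != 0 /\ T (T v) = l *: v.
Proof.
pose N := invmx H *m map_mx Num.conj (S *m invmx H) *m S.
have NE v : T (T v) = N *m v.
  have mapK (A : 'cV[C]_2) : map_mx Num.conj (map_mx Num.conj A) = A.
    by apply/matrixP => i j; rewrite !mxE conjCK.
  by rewrite /T mulmxA map_mxM mapK /N !mulmxA.
have [//|l /eigenvalueP [v vN v0]] := @eigenvalue_closed C 2 N^T.
exists l, v^T; split; first by rewrite -(inj_eq trmx_inj) trmxK trmx0.
by rewrite NE; apply: trmx_inj; rewrite trmx_mul trmxK vN linearZ /= trmxK.
Qed.

Lemma hform_antilin_eigen l v : T (T v) = l *: v -> h (T v) (T v) = l * h v v.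
Proof. by move=> e; rewrite hform_antilinC e hformZr. Qed.

Definition base v w : 'M[C]_2 := mat2 (v 0 0) (w 0 0) (v 1 0) (w 1 0).

Lemma base_col v w : col 0 (base v w) = v /\ col 1 (base v w) = w.
Proof. by rewrite [col 0 _]vec2_eta [col 1 _]vec2_eta !mxE -!vec2_eta. Qed.

Lemma base_det v w : \det (base v w) = v 0 0 * w 1 0 - w 0 0 * v 1 0.
Proof. exact: mat2_det. Qed.

Lemma base_gram v w :
  (base v w)^T *m S *m base v w = mat2 (s v v) (s v w) (s w v) (s w w) /\
  (base v w) ^t* *m H *m base v w = mat2 (h v v) (h v w) (h w v) (h w w).
Proof.
have [c0 c1] := base_col v w.
have formE (A M B : 'M[C]_2) i j : (A *m M *m B) i j = (row i A *m M *m col j B) 0 0.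
  by rewrite -row_mul [LHS]mxE [RHS]mxE; apply: eq_bigr => k _; rewrite !mxE.
by split; rewrite [LHS]mat2_eta !formE; rewrite -?map_row -!tr_col !c0 !c1.
Qed.

Lemma congruent_base v w : \det (base v w) != 0 ->
  congruent S H (mat2 (s v v) (s v w) (s w v) (s w w))
                (mat2 (h v v) (h v w) (h w v) (h w w)).
Proof.
move=> d0; exists (base v w), 1; have [<- <-] := base_gram v w.
by split; rewrite ?real1 ?oner_eq0 ?unitmxE ?unitfE ?scale1r.
Qed.

Lemma det_base_eq0 v w : v != 0 -> \det (base v w) = 0 -> exists a, w = a *: v.
Proof.
rewrite base_det [v in v != 0]vec2_eta => v0 /eqP; rewrite subr_eq0 => /eqP d.
have [z|n] := eqVneq (v 0 0) 0; last first.
  exists (w 0 0 / v 0 0); rewrite [LHS]vec2_eta [RHS]vec2_eta !mxE; congr vec2; first by field.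
  by apply: (mulfI n); rewrite d; field.
have n : v 1 0 != 0.
  by apply: contraNneq v0 => z'; rewrite z z'; apply/eqP/matrixP => i j; rewrite !mxE if_same.
exists (w 1 0 / v 1 0); rewrite [LHS]vec2_eta [RHS]vec2_eta !mxE; congr vec2; last by field.
by apply: (mulIf n); rewrite -d z; field.
Qed.

(** If T v = a v then T (T v) = |a|^2 v, and |a|^2 is nonnegative. *)
Lemma antilin_independent l v :
  v != 0 -> T (T v) = l *: v -> ~ 0 <= l -> \det (base v (T v)) != 0.
Proof.
move=> v0 e l0; apply/negP => /eqP /(det_base_eq0 v0) [a aE]; apply: l0.
move: e; rewrite aE antilinZ aE scalerA => /eqP; rewrite -subr_eq0 -scalerBl.
by rewrite scaler_eq0 (negPf v0) orbF subr_eq0 => /eqP <-; rewrite mulrC mul_conjC_ge0.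
Qed.

Lemma sform_antilin x y : s x y = (h x (T y))^*.
Proof. by rewrite hform_antilin conjCK. Qed.

Lemma hform_real x : h x x \is Num.real.
Proof. by rewrite CrealE hformC. Qed.

(** With r = sqrt l, applying T to r v + T v multiplies it by r.  This vector can
    vanish only if T v = - r v, and then i v does the job since T is antilinear. *)
Lemma antilin_real_eigenvector l v : v != 0 -> T (T v) = l *: v -> 0 <= l ->
  exists w, w != 0 /\ T w = sqrtC l *: w.
Proof.
move=> v0 e l0; set r := sqrtC l.
have rc : r^* = r by rewrite geC0_conj ?sqrtC_ge0.
have r2 : r * r = l by rewrite -expr2 sqrtCK.
have [z|n] := eqVneq (r *: v + T v) 0; last first.
  exists (r *: v + T v); split=> //.
  by rewrite antilinD rc e scalerDr scalerA r2 addrC.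
exists ('i *: v); split; first by rewrite scaler_eq0 negb_or neq0Ci.
have -> : T ('i *: v) = - 'i *: T v by rewrite antilinZ conjCi.
have -> : T v = - (r *: v) by apply/eqP; rewrite -addr_eq0 addrC z.
by rewrite scalerN scaleNr opprK !scalerA mulrC.
Qed.

(** The expression is the determinant of H in the basis (v, w). *)
Lemma hform_nondegenerate v w : \det (base v w) != 0 ->
  h v v * h w w - h v w * h w v != 0.
Proof.
move=> d0; rewrite -mat2_det; have [_ <-] := base_gram v w.
rewrite !det_mulmx det_map_mx det_tr !mulf_neq0 ?conjC_eq0 //.
by rewrite -unitfE -unitmxE.
Qed.

Lemma hform_row x y :
  h x y = (x ^t* *m H) 0 0 * y 0 0 + (x ^t* *m H) 0 1 * y 1 0.
Proof.
have e1 : lift ord0 ord0 = 1 :> 'I_2 by apply: val_inj.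
by rewrite /h [LHS]mxE !big_ord_recl big_ord0 addr0 e1.
Qed.

(** Multiplying k by a number of given modulus m can make it purely imaginary. *)
Lemma exists_rotation (k m : C) : 0 <= m ->
  exists b : C, b^* * b = m /\ b * k + (b * k)^* = 0.
Proof.
move=> m0; have [->|k0] := eqVneq k 0.
  have [b [b1 _]] := exists_phase 0 m0.
  by exists b; rewrite mulr0 rmorph0 addr0.
have nk : `|k| != 0 by rewrite normr_eq0.
have mc : (sqrtC m)^* = sqrtC m by rewrite geC0_conj ?sqrtC_ge0.
have nc : `|k|^* = `|k| by rewrite geC0_conj.
have k2 : `|k| ^+ 2 = k * k^* by rewrite normCK.
have m2 : sqrtC m ^+ 2 = m by rewrite sqrtCK.
have i2 := @sqrCi C.
exists ('i * k^* / `|k| * sqrtC m); split.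
  rewrite !rmorphM /= fmorphV /= conjCK conjCi mc nc.
  by rewrite -[RHS]m2; field: i2 k2.
by rewrite !rmorphM /= fmorphV /= conjCK conjCi mc nc; field.
Qed.

(** If h(v, v) <> 0, then [hform_antilin_eigen] makes l real, hence negative, and
    v and T v are eigenvectors of T^2 on which h has opposite signs.  So some
    v + b T v is isotropic: take |b|^2 = - 1 / l and b h(v, T v) imaginary. *)
Lemma antilin_isotropic l v : v != 0 -> T (T v) = l *: v -> ~ 0 <= l ->
  exists x, [/\ x != 0, T (T x) = l *: x & h x x = 0].
Proof.
move=> v0 e l0; have d0 := antilin_independent v0 e l0.
have [z|n] := eqVneq (h v v) 0; first by exists v.
have hw := hform_antilin_eigen e; set w := T v in d0 hw.
have lr : l \is Num.real.
  have -> : l = h w w / h v v by rewrite hw mulfK.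
  by rewrite rpred_div ?hform_real.
have lc : l^* = l by apply/CrealP.
have ln : l < 0 by case: (real_leP (real0 C) lr).
have Tw : T (T w) = l *: w by rewrite e antilinZ lc.
have m0 : 0 <= - l^-1 by rewrite oppr_ge0 invr_le0 ltW.
have [b [b1 b2]] := exists_rotation (h v w) m0.
exists (b *: w + v); split.
- apply: contraNneq d0 => z; rewrite base_det.
  have -> : v = - b *: w by apply/eqP; rewrite scaleNr -addr_eq0 addrC z.
  by rewrite !mxE; apply/eqP; ring.
- by rewrite !antilinD conjCK Tw e scalerDr !scalerA mulrC.
- rewrite hformDr !hformDl hw.
  have -> : b * (b^* * (l * h v v) + h v w) + (b^* * h w v + h v v) =
     (1 + l * (b^* * b)) * h v v + (b * h v w + b^* * h w v) by ring.
  rewrite b1 -(hformC v w) -rmorphM b2 mulrN divff ?lt_eqF //.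
  by rewrite subrr mul0r addr0.
Qed.

(** The three cases are: some eigenvalue of T^2 is not a nonnegative real; T has a
    nonisotropic eigenvector; T has an isotropic eigenvector with real
    eigenvalue s. *)
Lemma nondegenerate_trichotomy :
  [\/ exists A, [/\ 0 < 'Re A, 0 <= 'Im A &
        congruent S H (mat2 A 0 0 A^*) (mat2 0 ('i / 2) (- 'i / 2) 0)],
      exists a d p r, [/\ p \is Num.real, r \is Num.real, p != 0, r != 0 &
        congruent S H (mat2 a 0 0 d) (mat2 p 0 0 r)] |
      exists t s, 0 <= s /\ congruent S H (mat2 t s s 0) (mat2 0 1 1 0)].
Proof.
have [l [v [v0 e]]] := antilin_eigen.
have [l0|/negP l0] := boolP (0 <= l).
  have [w [w0 Tw]] := antilin_real_eigenvector v0 e l0.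
  set r := sqrtC l in Tw; have r0 : 0 <= r by rewrite sqrtC_ge0.
  set u0 := w ^t* *m H; have hwE y : h w y = u0 0 0 * y 0 0 + u0 0 1 * y 1 0.
    exact: hform_row.
  have [z|n] := eqVneq (h w w) 0.
    constructor 3.
    have u00 : u0 != 0.
      apply: contra_neq w0 => uz; apply: trmx_inj; rewrite trmx0.
      have : (w ^t*) = 0 by rewrite -[LHS](mulmxK Hu) -/u0 uz mul0mx.
      by move/matrixP => wz; apply/matrixP => i j; have /eqP := wz i j; rewrite !mxE
          conjC_eq0 => /eqP.
    (* Complete the isotropic vector w to a hyperbolic pair (u, w) with h(w, u) = 1:
       first find y with h(w, y) = 1, then correct it by a multiple of w. *)
    pose n := `|u0 0 0| ^+ 2 + `|u0 0 1| ^+ 2.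
    have n0 : n != 0.
      apply: contra_neq u00 => /eqP; rewrite paddr_eq0 ?exprn_ge0 // !expf_eq0 /= !normr_eq0.
      case/andP => /eqP z0 /eqP z1; apply/trmx_inj; rewrite trmx0 [RHS]vec2_eta mxE mxE.
      by rewrite [LHS]vec2_eta ![u0^T _ _]mxE z0 z1.
    pose y : 'cV[C]_2 := vec2 ((u0 0 0)^* / n) ((u0 0 1)^* / n).
    have hwy : h w y = 1.
      rewrite hwE [y 0 0]mxE [y 1 0]mxE /= !mulrA -!normCK -mulrDl.
      exact: divff.
    have hyw : h y w = 1 by rewrite -hformC hwy rmorph1.
    pose u := - (h y y / 2) *: w + y.
    have hwu : h w u = 1 by rewrite hformDr z mulr0 add0r.
    have huw : h u w = 1 by rewrite -hformC hwu rmorph1.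
    have huu : h u u = 0.
      rewrite hformDr huw hformDl hwy rmorphN rmorphM fmorphV rmorph_nat /= hformC.
      by field.
    have d0 : \det (base u w) != 0.
      apply/eqP => d; have [||a ua] := @det_base_eq0 w u => //.
        by apply/eqP; rewrite -oppr_eq0 -d !base_det; apply/eqP; ring.
      by move: hwu => /eqP; rewrite ua hformZr z mulr0 eq_sym oner_eq0.
    exists (s u u), r; split=> //.
    have := congruent_base d0; rewrite huu hwu huw z.
    have -> : s w w = 0 by rewrite sform_antilin Tw hformZr z mulr0 rmorph0.
    rewrite (sformC w u).
    have -> // : s u w = r.
    by rewrite sform_antilin Tw hformZr huw mulr1 geC0_conj.
  (* The vector u spans the orthogonal complement of w for h. *)
  constructor 2; pose u : 'cV[C]_2 := vec2 (u0 0 1) (- u0 0 0).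
  have hwu : h w u = 0 by rewrite hwE [u 0 0]mxE [u 1 0]mxE /=; ring.
  have huw : h u w = 0 by rewrite -hformC hwu rmorph0.
  have d0 : \det (base w u) != 0.
    rewrite base_det [u 0 0]mxE [u 1 0]mxE /=; apply: contra_neq n; rewrite hwE => d0.
    by apply/eqP; rewrite -oppr_eq0 -d0; apply/eqP; ring.
  have suw : s u w = 0 by rewrite sform_antilin Tw hformZr huw mulr0 rmorph0.
  have := hform_nondegenerate d0; rewrite hwu mul0r subr0 mulf_eq0 negb_or => /andP [p0 q0].
  exists (s w w), (s u u), (h w w), (h u u); split; rewrite ?hform_real //.
  by have := congruent_base d0; rewrite sformC suw hwu huw.
constructor 1.
have [x [{v v0 e} x0 e hx]] := antilin_isotropic v0 e l0.
have d0 := antilin_independent x0 e l0; set w := T x in d0 e.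
have hw : h w w = 0 by rewrite (hform_antilin_eigen e) hx mulr0.
have := hform_nondegenerate d0; rewrite hx mul0r sub0r oppr_eq0 mulf_eq0 negb_or.
case/andP=> k0 _; set k := h x w in k0.
(* A square root of - l / 4 has nonzero real part because l is not in [0, +oo[. *)
have [A [A0 lE]] : exists A, 0 < 'Re A /\ l = - 4 * A ^+ 2.
  pose B := sqrtC (- l / 4).
  have B2 : B ^+ 2 = - l / 4 by rewrite sqrtCK.
  have lB : l = - 4 * B ^+ 2 by rewrite B2; field.
  have [B0|B0|B0] := real_ltgtP (real0 C) (Creal_Re B).
  - by exists B.
  - by exists (- B); rewrite raddfN oppr_gt0 sqrrN.
  - case: l0; rewrite lB [B]Crect -B0 add0r exprMn sqrCi mulN1r mulrNN mulr_ge0 //.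
    by rewrite real_exprn_even_ge0 // Creal_Im.
have An : A != 0 by apply: contraTneq A0 => ->; rewrite raddf0 ltxx.
have c1 : congruent S H (mat2 A 0 0 A^*) (mat2 0 ('i / 2) (- 'i / 2) 0).
  apply: congruent_trans (congruent_antidiag k0 An).
  have := congruent_base d0.
  have -> : s x x = k^* by rewrite sform_antilin.
  have -> : s x w = 0 by rewrite sform_antilin e hformZr hx mulr0 rmorph0.
  rewrite sformC.
  have -> : s x w = 0 by rewrite sform_antilin e hformZr hx mulr0 rmorph0.
  rewrite hx hw -/k -(hformC x w) -/k.
  suff -> : s w w = - 4 * A^* ^+ 2 * k by [].
  rewrite sform_antilin e hformZr -(hformC x w) -/k lE !rmorphM /= conjCK rmorphN rmorph_nat.
  by ring.
have [ImA|ImA] := real_leP (real0 C) (Creal_Im A); first by exists A; split.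
exists A^*; split; rewrite ?Re_conj ?Im_conj ?oppr_ge0 ?ltW //.
by rewrite conjCK; apply: congruent_trans c1 (congruent_antidiag_conj A).
Qed.

End Antilinear.

(** * Pairs with degenerate hermitian part *)

Section Degenerate.
Variable (C : numClosedFieldType).
Implicit Types (a b d : C).

(** Completing the square with respect to the second variable if its square
    occurs in S; if only the mixed term occurs, the factor of z1 is taken as the
    second variable. *)
Lemma rank1_trichotomy a b d :
  [\/ exists A, 0 <= A /\
        congruent (mat2 a b b d) (mat2 1 0 0 0) (mat2 A 0 0 1) (mat2 1 0 0 0),
      congruent (mat2 a b b d) (mat2 1 0 0 0) (mat2 0 2^-1 2^-1 0) (mat2 1 0 0 0) |
      exists A, 0 <= A /\
        congruent (mat2 a b b d) (mat2 1 0 0 0) (mat2 A 0 0 0) (mat2 1 0 0 0)].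
Proof.
have two0 : 2 != 0 :> C by rewrite pnatr_eq0.
have unit0 (u : C) : u^* * u = 1 -> u != 0.
  by move=> e; apply: contra_eq_neq e => ->; rewrite mulr0 eq_sym oner_eq0.
have [d0|d0] := eqVneq d 0; last first.
  have [u [u1 u2]] := exists_phase (a - b ^+ 2 / d) ler01; have u0 := unit0 _ u1.
  constructor 1; exists (u ^+ 2 * (a - b ^+ 2 / d)); split=> //.
  pose q := sqrtC d; have qd : d = q ^+ 2 by rewrite sqrtCK.
  have q0 : q != 0 by rewrite sqrtC_eq0.
  apply: (@congruent_mat2 _ u 0 (- b * u / d) q^-1 1);
    rewrite ?rmorph0 ?oner_eq0 ?real1 //.
  - by rewrite mul0r subr0 mulf_neq0 ?invr_eq0.
  - by field.
  - by rewrite qd; field.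
  - by rewrite qd; field.
  - by rewrite !(mul1r, mulr1, mul0r, mulr0, addr0) u1.
  - by ring.
  - by rewrite !(mul0r, mulr0, addr0).
  - by ring.
have [b0|b0] := eqVneq b 0; last first.
  constructor 2; rewrite d0.
  apply: (@congruent_mat2 _ 1 0 (- a / (2 * b)) (2 * b)^-1 1);
    rewrite ?rmorph0 ?rmorph1 ?oner_eq0 ?real1 //; try (by ring); try (by field).
  by rewrite mul0r subr0 mul1r invr_eq0 mulf_neq0.
have [u [u1 u2]] := exists_phase a ler01; have u0 := unit0 _ u1.
constructor 3; exists (u ^+ 2 * a); split=> //; rewrite b0 d0.
apply: (@congruent_mat2 _ u 0 0 1 1);
  rewrite ?rmorph0 ?rmorph1 ?oner_eq0 ?real1 //; try (by ring).
- by rewrite mul0r subr0 mulr1.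
- by rewrite !(mul1r, mulr1, mul0r, mulr0, addr0) u1.
Qed.

(** For H = 0 only the rank of the complex quadratic form S matters. *)
Lemma rank0_trichotomy a b d :
  [\/ congruent (mat2 a b b d) 0 (mat2 1 0 0 1) 0,
      congruent (mat2 a b b d) 0 (mat2 1 0 0 0) 0 |
      mat2 a b b d = mat2 0 0 0 0].
Proof.
have -> : 0 = mat2 0 0 0 0 :> 'M[C]_2 by rewrite [LHS]mat2_eta !mxE.
have two0 : 2 != 0 :> C by rewrite pnatr_eq0.
wlog a0 : a d / a != 0 \/ (a = 0 /\ d = 0).
  move=> wl; have [a0|a0] := eqVneq a 0; last by apply: wl; left.
  have [d0|d0] := eqVneq d 0; first by apply: wl; right.
  have sw : congruent (mat2 a b b d) (mat2 0 0 0 0) (mat2 d b b a) (mat2 0 0 0 0).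
    apply: (@congruent_mat2 _ 0 1 1 0 1);
      rewrite ?rmorph0 ?rmorph1 ?oner_eq0 ?real1 //; try (by ring).
    by rewrite mul0r mul1r sub0r oppr_eq0 oner_eq0.
  have [|c|c|/mat2_inj [dz _ _ _]] := wl d a; first by left.
  - by constructor 1; apply: congruent_trans sw c.
  - by constructor 2; apply: congruent_trans sw c.
  - by rewrite dz eqxx in d0.
case: a0 => [a0|[-> ->]]; last first.
  have [->|b0] := eqVneq b 0; first by constructor 3.
  constructor 1; have i2 := @sqrCi C.
  apply: (@congruent_mat2 _ (2 * b)^-1 ('i / (2 * b)) 1 (- 'i) 1);
    rewrite ?oner_eq0 ?real1 //; try (by ring); try (by field: i2).
  have -> : (2 * b)^-1 * - 'i - 'i / (2 * b) * 1 = - 'i / b by field.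
  by rewrite mulf_neq0 ?oppr_eq0 ?neq0Ci ?invr_eq0.
pose q := sqrtC a; have qa : a = q ^+ 2 by rewrite sqrtCK.
have q0 : q != 0 by rewrite sqrtC_eq0.
pose e := d - b ^+ 2 / a; have de : d = e + b ^+ 2 / a by rewrite /e; ring.
have [e0|e0] := eqVneq e 0.
  constructor 2; apply: (@congruent_mat2 _ q^-1 (- b / a) 0 1 1);
    rewrite ?oner_eq0 ?real1 //; try (by ring).
  - by rewrite mulr0 subr0 mulr1 invr_eq0.
  - by rewrite qa; field.
  - by rewrite qa; field.
  - by rewrite de e0; field.
constructor 1; pose r := sqrtC e; have re : e = r ^+ 2 by rewrite sqrtCK.
have r0 : r != 0 by rewrite sqrtC_eq0.
apply: (@congruent_mat2 _ q^-1 (- b / (a * r)) 0 r^-1 1);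
  rewrite ?oner_eq0 ?real1 //; try (by ring).
- by rewrite mulr0 subr0 mulf_neq0 ?invr_eq0.
- by rewrite qa; field.
- by rewrite qa; field; rewrite q0 r0.
- by rewrite de re; field; rewrite r0 a0.
Qed.

End Degenerate.

(** * Congruence invariants *)

Section Invariants.
Variable (C : numClosedFieldType).
Implicit Types (S H P : 'M[C]_2).

Lemma congruent_det S H S' H' : congruent S H S' H' ->
  exists m, 0 < m /\ \det H' = m * \det H.
Proof.
move=> [P [c [Pu cr c0 _ eH]]].
exists (`|\det P| ^+ 2 / c ^+ 2); split.
  have c2 : 0 < c ^+ 2 by rewrite lt0r expf_eq0 c0 real_exprn_even_ge0.
  by rewrite divr_gt0 // exprn_gt0 // normr_gt0 -unitfE -unitmxE.
have := congr1 determinant eH; rewrite detZ !det_mulmx det_map_mx det_tr => e.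
apply: (mulfI (expf_neq0 2 c0)); rewrite -e normCK; field.
by rewrite c0.
Qed.

(** The matrix of the square of the antilinear operator [antilin] of (S, H). *)
Definition invariant_mx S H :=
  invmx H *m map_mx Num.conj S *m map_mx Num.conj (invmx H) *m S.

(** Both S and the inverse of H occur twice, so that the factor c cancels and the
    factors P^t and P^* meet their inverses. *)
Lemma congruent_invariant_mx S H S' H' : H \in unitmx -> H' \in unitmx ->
  congruent S H S' H' ->
  exists2 P, P \in unitmx & invariant_mx S' H' = invmx P *m invariant_mx S H *m P.
Proof.
move=> Hu Hu' [P [c [Pu cr c0 eS eH]]]; exists P => //.
have cc : c^* = c by apply/CrealP.
have Pcu : P ^t* \in unitmx by rewrite map_unitmx unitmx_tr.
have mapK m n (A : 'M[C]_(m, n)) : map_mx Num.conj (map_mx Num.conj A) = A.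
  by apply/matrixP => i j; rewrite !mxE conjCK.
have HE : invmx H' = c *: (invmx P *m invmx H *m invmx (P ^t*)).
  have : c *: (invmx P *m invmx H *m invmx (P ^t*)) *m H' = 1%:M.
    rewrite -scalemxAl scalemxAr -eH -!mulmxA (mulmxA (invmx (P ^t*))) mulVmx // mul1mx.
    by rewrite (mulmxA (invmx H)) mulVmx // mul1mx mulVmx.
  by move=> e; rewrite -[RHS](mulmxK Hu') e mul1mx.
have SE : S' = c^-1 *: (P^T *m S *m P) by rewrite eS scalerA mulVf // scale1r.
rewrite /invariant_mx HE SE !map_mxZ /= !map_mxM /= fmorphV /= cc.
rewrite !map_invmx /= mapK -!(scalemxAl, scalemxAr) !scalerA.
have -> : c^-1 * c * c / c = 1 by field.
have PTu : P^T \in unitmx by rewrite unitmx_tr.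
have Pcu' : map_mx Num.conj P \in unitmx by rewrite map_unitmx.
by rewrite scale1r !mulmxA (mulmxKV Pcu) (mulmxK Pcu') (mulmxKV PTu).
Qed.

Lemma congruent_invariants S H S' H' : H \in unitmx -> H' \in unitmx ->
  congruent S H S' H' ->
  [/\ \tr (invariant_mx S' H') = \tr (invariant_mx S H),
      \det (invariant_mx S' H') = \det (invariant_mx S H) &
      forall a, invariant_mx S H = a%:M -> invariant_mx S' H' = a%:M].
Proof.
move=> Hu Hu' /(congruent_invariant_mx Hu Hu') [P Pu ->]; split.
- by rewrite mxtrace_mulC mulKVmx.
- by rewrite 2!det_mulmx mulrAC -det_mulmx mulVmx // det1 mul1r.
- by move=> a ->; rewrite -mulmxA -scalar_mxC mulKmx.
Qed.

Lemma congruent_eq0 S H S' H' : congruent S H S' H' -> S = 0 -> S' = 0.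
Proof.
move=> [P [c [_ _ c0 eS _]]] S0; move: eS; rewrite S0 mulmx0 mul0mx => /eqP.
by rewrite eq_sym scaler_eq0 (negPf c0) => /eqP.
Qed.

End Invariants.

Section InvariantsNF.
Variable C : numClosedFieldType.

Lemma invmx_uniq (A B : 'M[C]_2) : A *m B = 1%:M -> A \in unitmx /\ invmx A = B.
Proof.
move=> e; have [Au _] := mulmx1_unit e; split=> //.
by rewrite -[LHS]mulmx1 -e mulKmx.
Qed.

Lemma invmx_diag_sign (e : C) : e * e = 1 ->
  mat2 1 0 0 e \in unitmx /\ invmx (mat2 1 0 0 e) = mat2 1 0 0 e.
Proof.
move=> ee; apply: invmx_uniq; rewrite mat2_mul mat2_1 ee; congr mat2; ring.
Qed.

Lemma invmx_off :
  (mat2 0 ('i / 2) (- 'i / 2) 0 : 'M[C]_2) \in unitmx /\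
  invmx (mat2 0 ('i / 2) (- 'i / 2) 0) = mat2 0 (2 * 'i) (- 2 * 'i) 0 :> 'M[C]_2.
Proof.
have i2 := @sqrCi C; apply: invmx_uniq; rewrite mat2_mul mat2_1; by congr mat2; field: i2.
Qed.

Lemma invariant_diag (a b e : C) : e * e = 1 -> e^* = e ->
  invariant_mx (mat2 a 0 0 b) (mat2 1 0 0 e) = mat2 (a^* * a) 0 0 (b^* * b).
Proof.
move=> ee ec; rewrite /invariant_mx (invmx_diag_sign ee).2 !mat2_map_conj !mat2_mul.
rewrite ec !rmorph0 rmorph1; congr mat2; try ring.
by transitivity (e * e * (b^* * b)); [ring | rewrite ee mul1r].
Qed.

Lemma invariant_off (a b d : C) :
  invariant_mx (mat2 a b b d) (mat2 0 ('i / 2) (- 'i / 2) 0) =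
  mat2 (4 * (b^* * b - d^* * a)) (4 * (b^* * d - d^* * b))
       (4 * (b^* * a - a^* * b)) (4 * (b^* * b - a^* * d)).
Proof.
have i2 := @sqrCi C; rewrite /invariant_mx invmx_off.2 !mat2_map_conj !mat2_mul.
rewrite !(rmorphM, rmorphN, rmorph0, rmorph_nat, conjCi) /= ?conjCi.
congr mat2; ring: i2.
Qed.

(** A congruence which preserves |z1|^2 up to a factor maps the first variable to
    a multiple of itself, so its matrix is triangular. *)
Lemma congruent_rank1 (a b d a' b' d' : C) :
  congruent (mat2 a b b d) (mat2 1 0 0 0) (mat2 a' b' b' d') (mat2 1 0 0 0) ->
  exists p r s, [/\ p != 0, s != 0,
     p^* * p * a' = a * p ^+ 2 + 2 * b * p * r + d * r ^+ 2,
     p^* * p * b' = (b * p + d * r) * s & p^* * p * d' = d * s ^+ 2].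
Proof.
move=> [P [c [Pu cr c0]]]; rewrite [P]mat2_eta in Pu *.
move: (P 0 0) (P 0 1) (P 1 0) (P 1 1) Pu => p q r s Pu.
rewrite mat2_tr mat2_map_conj !mat2_mul !mat2_scale => /mat2_inj [e1 e2 _ e3] /mat2_inj
    [f1 f2 _ f3].
have q0 : q = 0.
  by apply/eqP; rewrite -normr_eq0 -sqrf_eq0 normCK; apply/eqP; move: f3; rewrite
      !(mul0r,mulr0,mulr1,addr0) mulrC.
have cE : p^* * p = c by move: f1; rewrite !(mul0r,mulr0,mulr1,addr0).
move: Pu; rewrite unitmxE mat2_det unitfE q0 mul0r subr0 mulf_eq0 negb_or => /andP [p0 s0].
exists p, r, s; rewrite cE; split=> //; rewrite q0 in e1 e2 e3.
- by rewrite -e1; ring.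
- by rewrite -e2; ring.
- by rewrite -e3; ring.
Qed.

End InvariantsNF.

(** * Quadratic forms in coordinates *)

Section RealPart.
Variables (C : numClosedFieldType) (z w : C).

Definition coord_form (a b c d k l m n : C) : C :=
  'Re ((z * (a * z + b * w) + w * (c * z + d * w)) +
       (z^* * (k * z + l * w) + w^* * (m * z + n * w))).

Lemma coord_form_diag (a d e : C) : e^* = e ->
  'Re (a * z ^+ 2 + d * w ^+ 2) + z * z^* + e * (w * w^*) =
  coord_form a 0 0 d 1 0 0 e.
Proof.
move=> ee; rewrite /coord_form !ReE !(rmorphD, rmorphM, rmorph0, rmorph1) /= !conjCK ee.
by field.
Qed.

Lemma coord_form_offdiag (a b d : C) :
  'Re (a * z ^+ 2 + 2 * b * z * w + d * w ^+ 2) + 'Im (z * w^*) =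
  coord_form a b b d 0 ('i / 2) (- 'i / 2) 0.
Proof.
rewrite /coord_form !ReE !ImE.
rewrite !(rmorphD, rmorphN, rmorphM, rmorph0, rmorph1, fmorphV, conjCi, rmorph_nat) /=.
by rewrite !conjCK !conjCi; field.
Qed.

Lemma coord_form_rank1 : 'Re (z * w) + z * z^* = coord_form 0 2^-1 2^-1 0 1 0 0 0.
Proof.
rewrite /coord_form !ReE.
rewrite !(rmorphD, rmorphM, rmorph0, rmorph1, fmorphV, rmorph_nat) /=.
by rewrite !conjCK; field.
Qed.

Lemma coord_form_rank0 : 'Re (z ^+ 2 + w ^+ 2) = coord_form 1 0 0 1 0 0 0 0.
Proof. by rewrite /coord_form !(mul0r, mulr0, mul1r, addr0, add0r). Qed.

Lemma coord_form_real_diag (a d k n : C) :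
  a \is Num.real -> d \is Num.real -> k \is Num.real -> n \is Num.real ->
  coord_form a 0 0 d k 0 0 n =
  (k + a) * 'Re z ^+ 2 + (k - a) * 'Im z ^+ 2 +
  ((n + d) * 'Re w ^+ 2 + (n - d) * 'Im w ^+ 2).
Proof.
move=> /CrealP ar /CrealP dr /CrealP kr /CrealP nr; have i2 := @sqrCi C.
rewrite /coord_form !ReE !ImE !(rmorphD, rmorphM, rmorph0) /= !conjCK ar dr kr nr.
by field: i2.
Qed.

End RealPart.

Section QuadLine.
Variables (C : numClosedFieldType) (n : nat).
Implicit Types (S H : 'M[C]_n) (z v : 'cV[C]_n).

Definition quad S H z : C := (z^T *m S *m z) 0 0 + (z ^t* *m H *m z) 0 0.

Definition polar S H z v : C :=
  (z^T *m S *m v) 0 0 + (v^T *m S *m z) 0 0 +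
  ((z ^t* *m H *m v) 0 0 + (v ^t* *m H *m z) 0 0).

(** A quadratic form restricted to a real line is a polynomial of degree two
    whose constant and leading coefficients are the values of the form at the base
    point and at the direction. *)
Lemma quad_line S H z v t : t^* = t ->
  quad S H (z + t *: v) = quad S H z + t * polar S H z v + t ^+ 2 * quad S H v.
Proof.
move=> tr; rewrite /quad /polar !linearD !linearZ /= !map_mxD !map_mxZ /= tr.
rewrite !(mulmxDl, mulmxDr) -!(scalemxAl, scalemxAr).
have mD (A B : 'M[C]_1) : (A + B) 0 0 = A 0 0 + B 0 0 by rewrite mxE.
have mZ a (A : 'M[C]_1) : (a *: A) 0 0 = a * A 0 0 by rewrite mxE.
rewrite !(mD, mZ); ring.
Qed.

Lemma quad_scale S H z t : t^* = t -> quad S H (t *: z) = t ^+ 2 * quad S H z.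
Proof.
move=> tr; rewrite /quad [(t *: z)^T]linearZ /= map_mxZ /= tr -!(scalemxAl, scalemxAr).
have mZ a (A : 'M[C]_1) : (a *: A) 0 0 = a * A 0 0 by rewrite mxE.
rewrite !mZ; ring.
Qed.

Lemma quadZ S H z a : quad (a *: S) (a *: H) z = a * quad S H z.
Proof. by rewrite /quad -!scalemxAr -!scalemxAl !mxE mulrDr. Qed.

Lemma quad_mulmx S H (P : 'M[C]_n) z :
  quad S H (P *m z) = quad (P^T *m S *m P) (P ^t* *m H *m P) z.
Proof. by rewrite /quad !trmx_mul !map_mxM /= !mulmxA. Qed.

Lemma quadB S H S' H' z : quad (S - S') (H - H') z = quad S H z - quad S' H' z.
Proof.
rewrite /quad !(mulmxBl, mulmxBr).
have mB (A B : 'M[C]_1) : (A - B) 0 0 = A 0 0 - B 0 0.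
  by rewrite mxE [X in _ + X]mxE.
rewrite !mB; ring.
Qed.

End QuadLine.

(** The map f is the identity for the symmetric part of a form and the conjugation
    for its hermitian part. *)
Lemma twisted_mat2_form (C : numClosedFieldType) (f : C -> C) (a b c d : C)
    (z : 'cV[C]_2) :
  (map_mx f z^T *m mat2 a b c d *m z) 0 0 =
  f (z 0 0) * (a * z 0 0 + b * z 1 0) + f (z 1 0) * (c * z 0 0 + d * z 1 0).
Proof.
have e1 : lift ord0 ord0 = 1 :> 'I_2 by apply: val_inj.
have -> : map_mx f z^T *m mat2 a b c d *m z = map_mx f z^T *m
    vec2 (a * z 0 0 + b * z 1 0) (c * z 0 0 + d * z 1 0).
  by rewrite -mat2_vec -vec2_eta mulmxA.
by rewrite mxE !big_ord_recl big_ord0 e1 addr0 !mxE.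
Qed.

Lemma quad_mat2 (C : numClosedFieldType) (a b c d k l m n : C) (z : 'cV[C]_2) :
  'Re (quad (mat2 a b c d) (mat2 k l m n) z) =
  coord_form (z 0 0) (z 1 0) a b c d k l m n.
Proof.
have e := twisted_mat2_form id a b c d z; rewrite map_mx_id // in e.
by rewrite /quad /coord_form e twisted_mat2_form.
Qed.

Section CoordFormInj.
Variable C : numClosedFieldType.

(** Each coefficient is a combination of values at points with coordinates in
    0, 1, i, 1 + i. *)
Lemma coord_form_eq0 (a b d k l n : C) : k^* = k -> n^* = n ->
  (forall z w, coord_form z w a b b d k l l^* n = 0) ->
  [/\ a = 0, b = 0, d = 0 & [/\ k = 0, l = 0 & n = 0]].
Proof.
move=> kr nr q0; have i2 := @sqrCi C.
have qE z w : coord_form z w a b b d k l l^* n =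
  (a * z ^+ 2 + 2 * b * z * w + d * w ^+ 2 +
   (a^* * z^* ^+ 2 + 2 * b^* * z^* * w^* + d^* * w^* ^+ 2)) / 2 +
  k * z^* * z + n * w^* * w + l * z^* * w + l^* * w^* * z.
  by rewrite /coord_form ReE !(rmorphD, rmorphM) /= !conjCK kr nr; field.
have comb (x : C) : x = 0 -> forall y, y = x -> y = 0 by move=> -> y.
have k0 : k = 0.
  apply: (comb ((coord_form 1 0 a b b d k l l^* n + coord_form 'i 0 a b b d k l l^* n) / 2)).
    by rewrite !q0 addr0 mul0r.
  by rewrite !qE rmorph0 rmorph1 conjCi; field: i2.
have n0 : n = 0.
  apply: (comb ((coord_form 0 1 a b b d k l l^* n + coord_form 0 'i a b b d k l l^* n) / 2)).
    by rewrite !q0 addr0 mul0r.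
  by rewrite !qE rmorph0 rmorph1 conjCi; field: i2.
have a0 : a = 0.
  apply: (comb (coord_form 1 0 a b b d k l l^* n - 'i / 2 * coord_form (1 + 'i) 0 a b b d
      k l l^* n)).
    by rewrite !q0 mulr0 subr0.
  by rewrite !qE k0 rmorphD rmorph0 rmorph1 /= conjCi; field: i2.
have d0 : d = 0.
  apply: (comb (coord_form 0 1 a b b d k l l^* n - 'i / 2 * coord_form 0 (1 + 'i) a b b d
      k l l^* n)).
    by rewrite !q0 mulr0 subr0.
  by rewrite !qE n0 rmorphD rmorph0 rmorph1 /= conjCi; field: i2.
have b0 : b = 0.
  apply: (comb ((coord_form 1 1 a b b d k l l^* n - coord_form 'i 'i a b b d k l l^* n) / 4
     - 'i * (coord_form 1 'i a b b d k l l^* n + coord_form 'i 1 a b b d k l l^* n) / 4)).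
    by rewrite !q0 subr0 addr0 mulr0 mul0r subr0.
  by rewrite !qE a0 d0 k0 n0 rmorph1 conjCi rmorph0; field: i2.
have l0 : l = 0.
  apply: (comb ((coord_form 1 1 a b b d k l l^* n + coord_form 'i 'i a b b d k l l^* n) / 4
     - 'i * (coord_form 1 'i a b b d k l l^* n - coord_form 'i 1 a b b d k l l^* n) / 4)).
    by rewrite !q0 subr0 addr0 mulr0 mul0r subr0.
  by rewrite !qE a0 d0 k0 n0 rmorph1 conjCi rmorph0; field: i2.
by [].
Qed.

End CoordFormInj.

(** * The normal forms as pairs of matrices *)

Local Open Scope complex_scope.
Local Notation Re := complex.Re.
Local Notation Im := complex.Im.

Section NF.
Variable (R : realType).
Local Notation C := R[i].
Implicit Types (t : normal_form R).

Definition cform (S H : 'M[C]_2) (z : 'cV[C]_2) : R := Re (quad S H z).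

Definition nfS t : 'M[C]_2 :=
  match t with
  | NF20 A B | NF11_1 A B => mat2 A%:C 0 0 B%:C
  | NF11_2 A => mat2 A 0 0 (Num.conj A)
  | NF11_3 => mat2 1 0 0 0
  | NF11_4 A => mat2 1 ('i%R * A%:C / 2) ('i%R * A%:C / 2) 0
  | NF10_1 A => mat2 A%:C 0 0 1
  | NF10_2 => mat2 0 2^-1 2^-1 0
  | NF00_1 => mat2 1 0 0 1
  end.

Definition nfH t : 'M[C]_2 :=
  match t with
  | NF20 _ _ => mat2 1 0 0 1
  | NF11_1 _ _ => mat2 1 0 0 (-1)
  | NF11_2 _ | NF11_3 | NF11_4 _ => mat2 0 ('i%R / 2) (- 'i%R / 2) 0
  | NF10_1 _ | NF10_2 => mat2 1 0 0 0
  | NF00_1 => 0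
  end.

Lemma cformE z (a b c d k l m n : C) :
  (cform (mat2 a b c d) (mat2 k l m n) z)%:C =
  coord_form (z 0 0) (z 1 0) a b c d k l m n.
Proof. by rewrite -quad_mat2 -complexRe. Qed.

Lemma cform_real_diag z (a d k n : R) :
  cform (mat2 a%:C 0 0 d%:C) (mat2 k%:C 0 0 n%:C) z =
  (k + a) * Re (z 0 0) ^+ 2 + (k - a) * Im (z 0 0) ^+ 2 +
  ((n + d) * Re (z 1 0) ^+ 2 + (n - d) * Im (z 1 0) ^+ 2).
Proof.
have r (x : R) : x%:C \is Num.real by rewrite complex_real.
apply: complexI; rewrite cformE coord_form_real_diag // -!complexRe -!complexIm.
by rewrite !(rmorphD, rmorphN, rmorphM, rmorphXn).
Qed.

Lemma nf_rhoE t z : nf_rho t z = cform (nfS t) (nfH t) z.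
Proof.
have e0 : 0 = mat2 0 0 0 0 :> 'M[C]_2 by rewrite [LHS]mat2_eta !mxE.
have sq (w : C) : (sqnorm w)%:C = w * Num.conj w.
  have r : `|w| ^+ 2 \is Num.real by rewrite ger0_real ?exprn_ge0.
  by rewrite /sqnorm complexRe (Creal_ReP _ r) normCK.
have rD (x y : R) : (x + y)%:C = x%:C + y%:C :> C by rewrite rmorphD.
have rB (x y : R) : (x - y)%:C = x%:C - y%:C :> C by rewrite rmorphB.
apply: complexI; case: t => [A B|A B|A||A|A||]; rewrite /nfS /nfH ?e0 cformE /nf_rho.
- by rewrite 2!rD !sq complexRe -coord_form_diag ?rmorph1 // mul1r.
- by rewrite rB rD !sq complexRe -coord_form_diag ?rmorphN ?rmorph1 // mulN1r.
- rewrite rD complexRe complexIm -coord_form_offdiag.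
  by rewrite mulr0 !mul0r addr0.
- rewrite rD complexRe complexIm -coord_form_offdiag.
  by rewrite mulr0 !mul0r !addr0 mul1r.
- rewrite rD complexRe complexIm -coord_form_offdiag.
  rewrite mul0r !addr0 mul1r.
  by rewrite [2 * _]mulrC divfK ?pnatr_eq0.
- by rewrite rD sq complexRe -coord_form_diag ?rmorph0 // mul0r addr0 mul1r.
- by rewrite rD sq complexRe -coord_form_rank1.
- by rewrite complexRe -coord_form_rank0.
Qed.

Lemma nfH_det t :
  \det (nfH t) = match t with NF20 _ _ => 1 | NF11_1 _ _ => -1
                   | NF11_2 _ | NF11_3 | NF11_4 _ => - 4^-1 | _ => 0 end.
Proof.
have i2 := @sqrCi C.
by case: t => *; rewrite /nfH ?mat2_det ?det0 //; try ring; field: i2.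
Qed.

Lemma nfS_sym t : (nfS t)^T = nfS t.
Proof. by case: t => *; rewrite /nfS mat2_tr. Qed.

Lemma nfH_herm t : (nfH t) ^t* = nfH t.
Proof.
case: t => *; rewrite /nfH ?mat2_conj ?trmx0 ?map_mx0 ?rmorph0 ?rmorph1 ?rmorphN ?rmorph1 //;
  rewrite !rmorphM /= fmorphV rmorph_nat rmorphN /= conjCi opprK //.
Qed.

End NF.

(** * Distinct normal forms are not congruent *)

Section Uniq.
Variable (R : realType).
Local Notation C := R[i].
Implicit Types (t : normal_form R).

(** The trace and, below, the determinant of [invariant_mx] for the types with
    nondegenerate H; the value 0 for the other types is a mere default. *)
Definition nf_trace t : R :=
  match t with
  | NF20 A B | NF11_1 A B => A ^+ 2 + B ^+ 2
  | NF11_2 A => - 8 * (Re A ^+ 2 - Im A ^+ 2)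
  | NF11_4 A => 2 * A ^+ 2
  | _ => 0
  end.

Definition nf_det t : R :=
  match t with
  | NF20 A B | NF11_1 A B => A ^+ 2 * B ^+ 2
  | NF11_2 A => 16 * (Re A ^+ 2 + Im A ^+ 2) ^+ 2
  | NF11_4 A => A ^+ 4
  | _ => 0
  end.

Definition nondegenerate_type t := (nf_signature t == (2, 0))%N || (nf_signature t == (1, 1))%N.

Lemma nfH_unit t : nondegenerate_type t -> nfH t \in unitmx.
Proof.
by case: t => [A B|A B|A||A|A||] //= _; rewrite ?(invmx_diag_sign _).1 ?(invmx_off _).1
    ?mulr1 // mulrNN mulr1.
Qed.

Lemma nf_invariants t : nondegenerate_type t ->
  \tr (invariant_mx (nfS t) (nfH t)) = (nf_trace t)%:C /\
  \det (invariant_mx (nfS t) (nfH t)) = (nf_det t)%:C.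
Proof.
have rc (a : R) : Num.conj a%:C = a%:C :> C by exact: conjc_real.
have i2 := @sqrCi C.
case: t => [A B|A B|A||A|A||] //= _.
- rewrite invariant_diag ?mulr1 ?rmorph1 // mat2_trace mat2_det !rc.
  by rewrite !(rmorphD, rmorphM, rmorphXn) /=; split; ring.
- rewrite invariant_diag ?mulrNN ?mulr1 ?rmorphN ?rmorph1 // mat2_trace mat2_det !rc.
  by rewrite !(rmorphD, rmorphM, rmorphXn) /=; split; ring.
- have eA : A = (Re A)%:C + 'i%R * (Im A)%:C by rewrite complexRe complexIm -Crect.
  have eAc : Num.conj A = (Re A)%:C - 'i%R * (Im A)%:C.
    by rewrite {1}eA rmorphD rmorphM /= conjCi !rc mulNr.
  rewrite invariant_off mat2_trace mat2_det rmorph0 conjCK.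
  rewrite !(rmorphD, rmorphB, rmorphN, rmorphM, rmorphXn, rmorph_nat) /=.
  move: eA eAc; move: (Re A)%:C (Im A)%:C => X Y eA ->; rewrite eA.
  by split; ring: i2.
- rewrite invariant_off mat2_trace mat2_det rmorph0 rmorph1.
  by rewrite rmorph0; split; ring.
- rewrite invariant_off mat2_trace mat2_det rmorph0 rmorph1.
  rewrite !(rmorphM, fmorphV, rmorph_nat, rmorphXn) /= rc conjCi.
  by split; field: i2.
Qed.

Lemma sqr_inj_nneg (x y : R) : 0 <= x -> 0 <= y -> x ^+ 2 = y ^+ 2 -> x = y.
Proof. by move=> x0 y0 /eqP; rewrite eqrXn2 // => /eqP. Qed.

(** The squares are the roots of the same quadratic polynomial. *)
Lemma ordered_pair_uniq (A B A' B' : R) : 0 <= B -> B <= A -> 0 <= B' -> B' <= A' ->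
  A ^+ 2 + B ^+ 2 = A' ^+ 2 + B' ^+ 2 -> A ^+ 2 * B ^+ 2 = A' ^+ 2 * B' ^+ 2 ->
  A = A' /\ B = B'.
Proof.
move=> B0 BA B0' BA' s p.
have A0 := le_trans B0 BA; have A0' := le_trans B0' BA'.
have : (A ^+ 2 - A' ^+ 2) * (A ^+ 2 - B' ^+ 2) = 0.
  transitivity (A ^+ 4 - A ^+ 2 * (A' ^+ 2 + B' ^+ 2) + A' ^+ 2 * B' ^+ 2); first by ring.
  by rewrite -s -p; ring.
move/eqP; rewrite mulf_eq0 !subr_eq0 => /orP [] /eqP e.
  by split; apply: sqr_inj_nneg => //; move: s; rewrite e => /addrI.
have e' : B ^+ 2 = A' ^+ 2.
  by apply: (addrI (A ^+ 2)); rewrite s e addrC.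
have {}e := sqr_inj_nneg A0 B0' e; have {}e' := sqr_inj_nneg B0 A0' e'.
by split; lra.
Qed.

(** The eigenvalues of the invariant of NF11_2 are not in [0, +oo[, whereas a
    nonnegative trace p and discriminant d, together with the positive determinant
    q, would make them positive. *)
Lemma NF11_2_invariants_incompatible (x y p q d : R) : 0 < x ->
  - 8 * (x ^+ 2 - y ^+ 2) = p -> 16 * (x ^+ 2 + y ^+ 2) ^+ 2 = q ->
  d = p ^+ 2 - 4 * q -> 0 <= p -> 0 <= d -> False.
Proof.
move=> x0 <- <- ->.
have -> : (- 8 * (x ^+ 2 - y ^+ 2)) ^+ 2 - 4 * (16 * (x ^+ 2 + y ^+ 2) ^+ 2) =
  - 256 * (x ^+ 2 * y ^+ 2) by ring.
move=> p0 d0; have x2 : 0 < x ^+ 2 by rewrite exprn_gt0.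
have y0 : 0 < y ^+ 2 by lra.
by have := mulr_gt0 x2 y0; lra.
Qed.

(** The sign of det H separates the signatures (2,0), (1,1) and the degenerate
    ones; among the latter the vanishing of H decides. *)
Lemma nf_congruent_signature t t' :
  congruent (nfS t) (nfH t) (nfS t') (nfH t') -> nf_signature t = nf_signature t'.
Proof.
move=> c; have [m [m0 d]] := congruent_det c.
have eqH0 (u u' : normal_form R) : congruent (nfS u) (nfH u) (nfS u') (nfH u') -> nfH u =
    0 -> nfH u' = 0.
  move=> [P [k [_ _ k0 _ eH]]] H0; move: eH; rewrite H0 mulmx0 mul0mx => /eqP.
  by rewrite eq_sym scaler_eq0 (negPf k0) => /eqP.
have sg (u : normal_form R) : [\/ nf_signature u = (2, 0)%N /\ 0 < \det (nfH u),
   nf_signature u = (1, 1)%N /\ \det (nfH u) < 0,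
   nf_signature u = (1, 0)%N /\ (\det (nfH u) = 0 /\ nfH u != 0) |
   nf_signature u = (0, 0)%N /\ nfH u = 0].
  have h10 : mat2 1 0 0 0 != 0 :> 'M[C]_2.
    by apply/eqP => /matrixP /(_ 0 0) /eqP; rewrite !mxE oner_eq0.
  rewrite nfH_det; case: u => *; rewrite /nf_signature ?oppr_lt0 ?invr_gt0 ?ltr0n ?ltr01.
  - by constructor 1.
  - by constructor 2.
  - by constructor 2.
  - by constructor 2.
  - by constructor 2.
  - by constructor 3.
  - by constructor 3.
  - by constructor 4.
have := sg t; have := sg t'; rewrite d.
case=> [[-> p]|[-> p]|[-> [p n]]|[-> p]]; case=> [[-> q]|[-> q]|[-> [q k]]|[-> q]] //.
- by move: p; rewrite pmulr_rgt0 // => /(lt_trans q); rewrite ltxx.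
- by move: p; rewrite q mulr0 ltxx.
- by move: p; rewrite q det0 mulr0 ltxx.
- by move: p; rewrite pmulr_rlt0 // => /(lt_trans q); rewrite ltxx.
- by move: p; rewrite q mulr0 ltxx.
- by move: p; rewrite q det0 mulr0 ltxx.
- by have := mulf_neq0 (lt0r_neq0 m0) (lt0r_neq0 q); rewrite p eqxx.
- by have := mulf_neq0 (lt0r_neq0 m0) (ltr0_neq0 q); rewrite p eqxx.
- by rewrite (eqH0 _ _ c q) eqxx in n.
- by move: q; rewrite -(pmulr_rgt0 _ m0) -d p det0 ltxx.
- by move: q; rewrite -(pmulr_rlt0 _ m0) -d p det0 ltxx.
- by rewrite (eqH0 _ _ (congruent_sym c) p) eqxx in k.
Qed.

Theorem nf_congruent_uniq t t' : nf_in_range t -> nf_in_range t' ->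
  congruent (nfS t) (nfH t) (nfS t') (nfH t') -> t = t'.
Proof.
move=> rt rt' c; have sg := nf_congruent_signature c.
(* Congruence is symmetric, so each unordered pair of types is treated once. *)
wlog: t t' rt rt' c sg / (match t, t' with
  | NF20 _ _, _ | NF11_1 _ _, _ | NF10_1 _, _ | NF00_1, _ => true
  | NF11_2 _, (NF11_2 _ | NF11_3 | NF11_4 _) => true
  | NF11_3, (NF11_3 | NF11_4 _) => true
  | NF11_4 _, NF11_4 _ => true
  | NF10_2, NF10_2 => true | _, _ => false end).
  move=> wl; have wl1 := wl _ _ rt rt' c sg.
  have wl2 := wl _ _ rt' rt (congruent_sym c) (esym sg).
  by case: t t' sg {wl rt rt' c} wl1 wl2 => [A B|A B|A||A|A||] [A' B'|A' B'|A'||A'|A'||]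
      //= _ w1 w2;
    solve [exact: w1 | exact/esym/w2].
have tri : nondegenerate_type t -> nf_trace t' = nf_trace t /\ nf_det t' = nf_det t /\
   forall a, invariant_mx (nfS t) (nfH t) = a%:M -> invariant_mx (nfS t') (nfH t') = a%:M.
  move=> n; have n' : nondegenerate_type t' by rewrite /nondegenerate_type -sg.
  have [e1 e2 e3] := congruent_invariants (nfH_unit n) (nfH_unit n') c.
  have [f1 f2] := nf_invariants n; have [g1 g2] := nf_invariants n'.
  by split; [apply: complexI; rewrite -f1 -g1 | split; [apply: complexI; rewrite -f2 -g2|]].
have S0 := congruent_eq0 c.
case: t t' rt rt' sg c tri S0 => [A B|A B|A||A|A||] [A' B'|A' B'|A'||A'|A'||] //=.
- move=> [B0 BA _] [B0' BA' _] _ _ /(_ isT) [e1 [e2 _]] _ _.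
  by have [-> ->] := ordered_pair_uniq B0' BA' B0 BA e1 e2.
- move=> [B0 BA] [B0' BA'] _ _ /(_ isT) [e1 [e2 _]] _ _.
  by have [-> ->] := ordered_pair_uniq B0' BA' B0 BA e1 e2.
- move=> [B0 BA] [x0 y0] _ _ /(_ isT) [e1 [e2 _]] _ _; exfalso.
  have := NF11_2_invariants_incompatible x0 e1 e2.
  have d : (A ^+ 2 - B ^+ 2) ^+ 2 = (A ^+ 2 + B ^+ 2) ^+ 2 - 4 * (A ^+ 2 * B ^+ 2) by ring.
  by move=> /(_ _ d); apply; rewrite ?sqr_ge0 ?addr_ge0 ?sqr_ge0.
- move=> [B0 BA] _ _ _ /(_ isT) [e1 [e2 _]] S0 _; exfalso.
  have /andP [/eqP A0 /eqP B0'] : (A ^+ 2 == 0) && (B ^+ 2 == 0).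
    by rewrite -paddr_eq0 ?sqr_ge0 // -e1.
  have /S0 /matrixP /(_ 0 0) /eqP : mat2 A%:C 0 0 B%:C = 0.
    move/eqP: A0; move/eqP: B0'; rewrite !expf_eq0 /= => /eqP -> /eqP ->.
    by rewrite [LHS]mat2_eta [RHS]mat2_eta !mxE.
  by rewrite !mxE oner_eq0.
- move=> [B0 BA] A0' _ _ /(_ isT) [e1 [e2 e3]] _ _; exfalso.
  (* The invariant of NF11_4 has a double eigenvalue without being scalar, and that
     of NF11_1 is diagonal. *)
  have AB : A = B.
    apply: sqr_inj_nneg => //; first exact: le_trans BA.
    apply/eqP; rewrite -subr_eq0 -sqrf_eq0; apply/eqP.
    transitivity ((A ^+ 2 + B ^+ 2) ^+ 2 - 4 * (A ^+ 2 * B ^+ 2)); first by ring.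
    by rewrite -e1 -e2; ring.
  have rc (a : R) : Num.conj a%:C = a%:C :> C by exact: conjc_real.
  have := e3 (Num.conj B%:C * B%:C); rewrite AB invariant_diag ?mulrNN ?mulr1 ?rmorphN ?rmorph1 //.
  have -> : mat2 (Num.conj B%:C * B%:C) 0 0 (Num.conj B%:C * B%:C) = (Num.conj B%:C * B%:C)%:M.
    by rewrite [RHS]mat2_eta !mxE.
  move=> /(_ erefl) /matrixP /(_ 1 0); rewrite invariant_off !mxE /= rmorph1.
  rewrite !(rmorphM, fmorphV, rmorph_nat) /= rc conjCi => e.
  have : 'i%R * A'%:C = 0 by apply: (mulfI (_ : - 4 != 0)); rewrite ?oppr_eq0 ?pnatr_eq0
      // mulr0 -[RHS]e; field.
  by move/eqP; rewrite mulf_eq0 (negPf (neq0Ci _)) /= => /eqP /complexI A00; rewrite A00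
      ltxx in A0'.
- move=> [x0 y0] [x0' y0'] _ _ /(_ isT) [e1 [e2 _]] _ _; congr NF11_2.
  have s : Re A' ^+ 2 + Im A' ^+ 2 = Re A ^+ 2 + Im A ^+ 2.
    by apply: sqr_inj_nneg; rewrite ?addr_ge0 ?sqr_ge0 //; lra.
  apply/eqP; rewrite eq_complex; apply/andP; split; apply/eqP; apply: sqr_inj_nneg;
      rewrite ?(ltW x0) ?(ltW x0') //; lra.
- move=> [x0 y0] _ _ _ /(_ isT) [e1 [e2 _]] _ _; exfalso.
  have : 0 < (Re A ^+ 2 + Im A ^+ 2) ^+ 2 by rewrite exprn_gt0 // ltr_pwDl ?exprn_gt0 ?sqr_ge0.
  by lra.
- move=> [x0 y0] A0' _ _ /(_ isT) [e1 [e2 _]] _ _; exfalso.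
  have := NF11_2_invariants_incompatible x0 (esym e1) (esym e2).
  by move=> /(_ 0); apply; rewrite ?mulr_ge0 ?ler0n ?(ltW A0') //; ring.
- move=> _ A0' _ _ /(_ isT) [e1 _] _ _; exfalso.
  by have := exprn_gt0 2 A0'; lra.
- move=> A0 A0' _ _ /(_ isT) [e1 _] _ _; congr NF11_4.
  by apply: sqr_inj_nneg; rewrite ?ltW //; lra.
- move=> A0 A0' _ /congruent_rank1 [p [r [s [p0 s0 e1 e2 e3]]]] _ _ _; congr NF10_1.
  have r0 : r = 0.
    move/eqP: e2; rewrite mulr0 mul0r add0r mul1r eq_sym mulf_eq0 (negPf s0) orbF.
    by move/eqP.
  move: e1; rewrite r0 !(mulr0, mul0r, addr0, expr0n) /= => e1.
  have : `|p| ^+ 2 * `|A'%:C| = `|p| ^+ 2 * `|A%:C|.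
    have := congr1 (fun x => `|x|) e1; rewrite !normrM norm_conjC => e.
    by rewrite expr2 e mulrC.
  move/(mulfI _) => /(_ _); rewrite expf_neq0 ?normr_eq0 // => /(_ isT).
  by rewrite !ger0_norm ?lecR // => /complexI.
- move=> A0 _ _ /congruent_rank1 [p [r [s [p0 s0 _ _]]]] /esym/eqP.
  by rewrite mulr0 mul1r expf_eq0 /= (negPf s0).
Qed.

End Uniq.

(** * Existence of a normal form *)

Section ExistenceNF.
Variable (R : realType).
Local Notation C := R[i].
Implicit Types (t : normal_form R) (S H : 'M[C]_2).

Definition indefinite (T : Type) (f : T -> R) := (exists x, 0 < f x) /\ (exists y, f y < 0).

Lemma cformZ S H (c : R) z : cform (c%:C *: S) (c%:C *: H) z = c * cform S H z.
Proof. by rewrite /cform quadZ; case: (quad S H z) => x y /=; rewrite mul0r subr0. Qed.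

Lemma cform_mulmx S H P z :
  cform S H (P *m z) = cform (P^T *m S *m P) (P ^t* *m H *m P) z.
Proof. by rewrite /cform quad_mulmx. Qed.

Lemma congruent_cform S H S' H' : congruent S H S' H' ->
  exists P (c : R), [/\ P \in unitmx, c != 0 &
    forall z, cform S H (P *m z) = c * cform S' H' z].
Proof.
move=> [P [c [Pu cr c0 eS eH]]]; exists P, (Re c).
have cc : c = (Re c)%:C by rewrite RRe_real.
split=> //; first by apply: contra_neq c0 => z; rewrite cc z.
by move=> z; rewrite cform_mulmx -cformZ -cc -eS -eH.
Qed.

Lemma congruent_indefinite S H S' H' : congruent S H S' H' ->
  indefinite (cform S H) -> indefinite (cform S' H').
Proof.
move=> /congruent_cform [P [c [Pu c0 cE]]] [[x fx] [y fy]].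
have e z : cform S H z = c * cform S' H' (invmx P *m z) by rewrite -cE mulKVmx.
move: fx fy; rewrite !e; have [cn|cp|cz] := ltrgt0P c; last by rewrite cz eqxx in c0.
  by rewrite pmulr_rgt0 // pmulr_rlt0 // => fx fy; split; [exists (invmx P *m x) | exists
      (invmx P *m y)].
by rewrite nmulr_rgt0 // nmulr_rlt0 // => fx fy; split; [exists (invmx P *m y) | exists
    (invmx P *m x)].
Qed.

Lemma card_pred_I2 (p : pred 'I_2) : #|p| = (p 0%R + p 1%R)%N.
Proof.
rewrite -sum1_card big_mkcond !big_ord_recl big_ord0 /=.
have -> : lift ord0 ord0 = 1 :> 'I_2 by apply: val_inj.
by rewrite !unfold_in; case: (p _); case: (p _).
Qed.

(** For A <= 1 all coefficients of the form in real coordinates are nonnegative. *)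
Lemma nf20_gt1 (A B : R) : 0 <= B -> B <= A ->
  indefinite (cform (mat2 A%:C 0 0 B%:C) (mat2 1 0 0 1)) -> 1 < A.
Proof.
move=> B0 BA [_ [y]]; rewrite (cform_real_diag y A B 1 1) => fy.
rewrite ltNge; apply/negP => A1; move: fy; rewrite ltNge => /negP; apply.
have sq (u v : R) : 0 <= u -> 0 <= u * v ^+ 2 by move=> u0; rewrite mulr_ge0 ?sqr_ge0.
by apply: addr_ge0; apply: addr_ge0; apply: sq; lra.
Qed.

Lemma signature_of_det_sign S H t : congruent S H (nfS t) (nfH t) -> nondegenerate_type t ->
  (0 < \det H -> nf_signature t = (2, 0)%N) /\
  (\det H < 0 -> nf_signature t = (1, 1)%N).
Proof.
move=> /congruent_det [m [m0]] e.
have neg : - 4^-1 < 0 :> C by rewrite oppr_lt0 invr_gt0 ltr0n.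
rewrite nfH_det in e.
case: t e => [A B|A B|A||A|A||] //= e _; split=> // dH; exfalso.
- by move: dH; rewrite -(pmulr_rlt0 _ m0) -e ltr10.
- by move: dH; rewrite -(pmulr_rgt0 _ m0) -e oppr_gt0 ltr10.
- by move: dH; rewrite -(pmulr_rgt0 _ m0) -e => /(lt_trans neg); rewrite ltxx.
- by move: dH; rewrite -(pmulr_rgt0 _ m0) -e => /(lt_trans neg); rewrite ltxx.
- by move: dH; rewrite -(pmulr_rgt0 _ m0) -e => /(lt_trans neg); rewrite ltxx.
Qed.

Lemma exists_nondegenerate S H : S^T = S -> H ^t* = H -> H \in unitmx ->
  indefinite (cform S H) ->
  exists t, [/\ nondegenerate_type t, nf_in_range t & congruent S H (nfS t) (nfH t)].
Proof.
move=> Ss Hh Hu ind.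
have toR (A : C) : 0 <= A -> exists2 a : R, A = a%:C & 0 <= a.
  move=> A0; exists (Re A); first by rewrite RRe_real ?ger0_real.
  by rewrite -ler0c RRe_real ?ger0_real.
have [[A [A0 A1 c]]|[a [d [p [r [pr rr p0 r0 c]]]]]|[u [s [s0 c]]]] :=
    nondegenerate_trichotomy Ss Hh Hu.
- exists (NF11_2 A); split=> //; rewrite /= -ltcR -lecR complexRe complexIm; by split.
- have [A [B [e [B0 BA eE c']]]] := congruent_diag a d pr rr p0 r0.
  have A0 := le_trans B0 BA.
  have {c c'}c := congruent_trans c c'.
  have [A' AE A0'] := toR _ A0; have [B' BE B0'] := toR _ B0; subst A B.
  rewrite lecR in BA.
  have [pos|neg|z] := real_ltgtP (real0 C) (realM pr rr).
  + move: eE c; rewrite gtr0_sg // => -> c; exists (NF20 A' B'); split=> //=.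
    by split=> //; apply: nf20_gt1 (congruent_indefinite c ind).
  + by move: eE c; rewrite ltr0_sg // => -> c; exists (NF11_1 A' B').
  + by have := mulf_neq0 p0 r0; rewrite -z eqxx.
- have [[A [A0 c']]|c'|[A [A0 c']]] := congruent_isotropic u s0; have {c'}c := congruent_trans c c'.
  + by have [A' AE A0'] := toR _ A0; subst A; exists (NF11_1 A' A').
  + by exists NF11_3.
  + have [A' AE A0'] := toR _ (ltW A0); subst A; exists (NF11_4 A'); split=> //=.
    by rewrite -ltcR.
Qed.

Lemma hermsymmx_of_adjoint H : H ^t* = H -> H \is hermsymmx.
Proof. by move=> Hh; rewrite is_hermitianmxE expr0 scale1r Hh. Qed.

Lemma congruent_spectral S H : S^T = S -> H ^t* = H ->
  let d := spectral_diag H in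
  exists S', [/\ S'^T = S', d 0 0 \is Num.real, d 0 1 \is Num.real &
    congruent S H S' (mat2 (d 0 0) 0 0 (d 0 1))].
Proof.
move=> Ss Hh d; have Hs := hermsymmx_of_adjoint Hh.
have U := spectral_unitarymx H; have Uu := unitarymx_unit U.
have HE := orthomx_spectralP (hermitian_normalmx Hs).
have dr := hermitian_spectral_diag_real Hs.
exists ((invmx (spectralmx H))^T *m S *m invmx (spectralmx H)); split.
- by rewrite !trmx_mul trmxK Ss mulmxA.
- by have /mxOverP := dr; apply.
- by have /mxOverP := dr; apply.
- exists (invmx (spectralmx H)), 1; split; rewrite ?unitmx_inv ?real1 ?oner_eq0 ?scale1r //.
  have -> : (invmx (spectralmx H)) ^t* = spectralmx H by rewrite invmx_unitary // trmxCK.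
  rewrite {2}HE !mulmxA mulmxV // mul1mx mulmxK //.
  by rewrite [LHS]mat2_eta !mxE.
Qed.

Lemma signature_cases H (pi nu : nat) : H ^t* = H ->
  pi = num_pos_eigenvalues H -> nu = num_neg_eigenvalues H -> (nu <= pi)%N ->
  let d := spectral_diag H in
  [\/ (pi, nu) = (2, 0)%N /\ 0 < d 0 0 * d 0 1,
      (pi, nu) = (1, 1)%N /\ d 0 0 * d 0 1 < 0,
      (pi, nu) = (1, 0)%N /\ ((d 0 0 != 0 /\ d 0 1 = 0) \/ (d 0 0 = 0 /\ d 0 1 != 0)) |
      (pi, nu) = (0, 0)%N /\ (d 0 0 = 0 /\ d 0 1 = 0)].
Proof.
move=> Hh; have Hs := hermsymmx_of_adjoint Hh => /= piE nuE le.
have /mxOverP dr := hermitian_spectral_diag_real Hs.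
move: piE nuE; rewrite /num_pos_eigenvalues /num_neg_eigenvalues !card_pred_I2 /=.
move: (dr 0 0) (dr 0 1); move: (spectral_diag H 0 0) (spectral_diag H 0 1) => a b ar br piE nuE.
move: le piE nuE; have [a0|a0|<-] := real_ltgtP (real0 C) ar; have [b0|b0|<-] :=
    real_ltgtP (real0 C) br;
  rewrite ?(mulr0, mul0r) => le piE nuE; move: le; rewrite piE nuE //= => _.
- by constructor 1; rewrite mulr_gt0.
- by constructor 2; rewrite pmulr_rlt0.
- by constructor 3; split=> //; left; split=> //; exact: (lt0r_neq0 a0).
- by constructor 2; rewrite nmulr_rlt0.
- by constructor 3; split=> //; right; split=> //; exact: (lt0r_neq0 b0).
- by constructor 4.
Qed.

End ExistenceNF.

Section ExistenceNF.
Variable (R : realType).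
Local Notation C := R[i].
Implicit Types (t : normal_form R) (S H : 'M[C]_2).

(** The last hypothesis excludes the forms in one complex variable, which
    [split_reducible] shows to have reducible zero sets. *)
Lemma exists_normal_form S H (pi nu : nat) : S^T = S -> H ^t* = H ->
  indefinite (cform S H) ->
  pi = num_pos_eigenvalues H -> nu = num_neg_eigenvalues H -> (nu <= pi)%N ->
  (forall A e : R, ~ congruent S H (mat2 A%:C 0 0 0) (mat2 e%:C 0 0 0)) ->
  exists t, [/\ nf_signature t = (pi, nu), nf_in_range t & congruent S H (nfS t) (nfH t)].
Proof.
move=> Ss Hh ind piE nuE le ns.
have /= sgn := signature_cases Hh piE nuE le.
have /= [S' [S's ar br c]] := congruent_spectral Ss Hh.
move: (spectral_diag H 0 0) (spectral_diag H 0 1) sgn ar br c => a b /= sgn ar br c.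
have [m [m0 dE]] := congruent_det c; rewrite mat2_det mulr0 subr0 in dE.
have nd : a * b != 0 -> H \in unitmx.
  by rewrite dE mulf_eq0 negb_or => /andP [_ h]; rewrite unitmxE unitfE.
have S'E : S' = mat2 (S' 0 0) (S' 0 1) (S' 0 1) (S' 1 1).
  by rewrite {1}[S']mat2_eta -{3}S's mxE.
rewrite S'E in c; move: (S' 0 0) (S' 0 1) (S' 1 1) c => p q r c {S' S's S'E}.
case: sgn => [[-> ab]|[-> ab]|[-> h]|[-> [a0 b0]]].
- have [t [tn tr tc]] := exists_nondegenerate Ss Hh (nd (lt0r_neq0 ab)) ind.
  exists t; split=> //; apply: (signature_of_det_sign tc tn).1.
  by rewrite -(pmulr_rgt0 _ m0) -dE.
- have [t [tn tr tc]] := exists_nondegenerate Ss Hh (nd (ltr0_neq0 ab)) ind.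
  exists t; split=> //; apply: (signature_of_det_sign tc tn).2.
  by rewrite -(pmulr_rlt0 _ m0) -dE.
- have [p' [q' [r' c']]] : exists p' q' r', congruent S H (mat2 p' q' q' r') (mat2 1 0 0 0).
    case: h c => [[a0 ->]|[-> b0]] c.
      exists (p / a), (q / a), (r / a); apply: congruent_trans c _.
      apply: (@congruent_mat2 _ 1 0 0 1 a); rewrite ?rmorph0 ?rmorph1 //; try (by ring);
          try (by field).
      by rewrite mulr1 mulr0 subr0 oner_eq0.
    exists (r / b), (q / b), (p / b); apply: congruent_trans c _.
    apply: (@congruent_mat2 _ 0 1 1 0 b); rewrite ?rmorph0 ?rmorph1 //; try (by ring);
        try (by field).
    by rewrite mulr0 mulr1 sub0r oppr_eq0 oner_eq0.
  have [[A [A0 d]]|d|[A [A0 d]]] := rank1_trichotomy p' q' r'; have e := congruent_trans c' d.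
  + have [A' AE A0'] : exists2 A' : R, A = A'%:C & 0 <= A'.
      exists (Re A); first by rewrite RRe_real ?ger0_real.
      by rewrite -ler0c RRe_real ?ger0_real.
    by subst A; exists (NF10_1 A').
  + by exists NF10_2.
  + by exfalso; apply: (ns (Re A) 1); rewrite RRe_real ?ger0_real.
- have z2 : mat2 0 0 0 0 = 0 :> 'M[C]_2 by rewrite [RHS]mat2_eta !mxE.
  have z2' : mat2 (0 : R)%:C 0 0 0 = 0 :> 'M[C]_2 by exact: z2.
  rewrite a0 b0 z2 in c.
  have [d|d|d] := rank0_trichotomy p q r.
  + by exists NF00_1; split=> //; apply: congruent_trans c d.
  + by exfalso; apply: (ns 1 0); rewrite z2'; apply: congruent_trans c d.
  + by exfalso; apply: (ns 0 0); rewrite z2'; rewrite d z2 in c.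
Qed.

(** A hyperplane is algebraic: this gives the polynomial of a real linear form. *)
Lemma real_linear_algebraic n (c : 'cV[C]_n) :
  exists p, forall z : 'cV[C]_n, real_eval p z = Re (\sum_j c j 0 * z j 0).
Proof.
pose X k : mpoly.mpoly (n + n) R := mpoly.mpolyX R (mpoly.mnm1 k).
exists (\sum_(j < n) (Re (c j 0) *: X (lshift n j) - Im (c j 0) *: X (rshift n j))) => z.
rewrite /real_eval raddf_sum /=.
have -> : Re (\sum_j c j 0 * z j 0) = \sum_j Re (c j 0 * z j 0).
  by apply: complexI; rewrite complexRe raddf_sum rmorph_sum; apply: eq_bigr => j _;
      rewrite /= complexRe.
apply: eq_bigr => j _; rewrite mpoly.mevalB !mpoly.mevalZ !mpoly.mevalXU /real_coords.
have -> : fintype.split (lshift n j) = inl j by exact: (unsplitK (inl j)).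
have -> : fintype.split (rshift n j) = inr j by exact: (unsplitK (inr j)).
by case: (c j 0) (z j 0) => a b [x y].
Qed.

Lemma cform_rank1 z (A e : R) :
  cform (mat2 A%:C 0 0 0) (mat2 e%:C 0 0 0) z =
  (e + A) * Re (z 0 0) ^+ 2 + (e - A) * Im (z 0 0) ^+ 2.
Proof.
have := cform_real_diag z A 0 e 0; rewrite subr0 addr0 !mul0r !addr0 => <- //.
Qed.

(** In suitable coordinates the form is (e + A) x^2 + (e - A) y^2 with x + i y the
    first coordinate.  The coefficients have opposite signs, so this is a product
    of two real linear forms, neither of which vanishes on the zeros of the other. *)
Lemma split_reducible S H (A e : R) :
  congruent S H (mat2 A%:C 0 0 0) (mat2 e%:C 0 0 0) -> indefinite (cform S H) ->
  ~ irreducible_algebraic [set z | cform S H z = 0].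
Proof.
move=> c ind [_ _ irr].
have [[x px] [y py]] := congruent_indefinite c ind.
have [P [k [Pu k0 cE]]] := congruent_cform c.
rewrite !cform_rank1 in px py.
have [a [b [s [s0 a0 b0 ea eb]]]] : exists a b s : R, [/\ s != 0, a != 0, b != 0,
    e + A = s * a ^+ 2 & e - A = - s * b ^+ 2].
  have x2 := sqr_ge0 (Re (x 0 0)); have x2' := sqr_ge0 (Im (x 0 0)).
  have y2 := sqr_ge0 (Re (y 0 0)); have y2' := sqr_ge0 (Im (y 0 0)).
  have [u0|u0] := ltP 0 (e + A); have [v0|v0] := ltP 0 (e - A).
  - by exfalso; have := addr_ge0 (mulr_ge0 (ltW u0) y2) (mulr_ge0 (ltW v0) y2'); lra.
  - have v0' : e - A < 0.
      rewrite lt_neqAle v0 andbT; apply/eqP => v; move: py; rewrite v mul0r addr0 ltNge.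
      by rewrite mulr_ge0 // ltW.
    exists (Num.sqrt (e + A)), (Num.sqrt (- (e - A))), 1; split.
    + exact: oner_neq0.
    + by rewrite sqrtr_eq0 -ltNge.
    + by rewrite sqrtr_eq0 -ltNge oppr_gt0.
    + by rewrite sqr_sqrtr ?mul1r // ltW.
    + by rewrite sqr_sqrtr ?oppr_ge0 // mulrNN mul1r.
  - have u0' : e + A < 0.
      rewrite lt_neqAle u0 andbT; apply/eqP => v; move: py; rewrite v mul0r add0r ltNge.
      by rewrite mulr_ge0 // ltW.
    exists (Num.sqrt (- (e + A))), (Num.sqrt (e - A)), (-1); split.
    + by rewrite oppr_eq0 oner_neq0.
    + by rewrite sqrtr_eq0 -ltNge oppr_gt0.
    + by rewrite sqrtr_eq0 -ltNge.
    + by rewrite sqr_sqrtr ?oppr_ge0 // mulrNN mul1r.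
    + by rewrite sqr_sqrtr ?opprK ?mul1r // ltW.
  - exfalso; have := addr_ge0 (mulr_ge0 (_ : 0 <= - (e + A)) x2) (mulr_ge0 (_ : 0 <= - (e
      - A)) x2').
    by rewrite !oppr_ge0 => /(_ u0 v0); lra.
(* The two hyperplanes are Y 1 and Y (-1), and s is the sign of e + A. *)
pose Q := invmx P; pose w (z : 'cV[C]_2) := (Q *m z) 0 0.
pose Y (f : R) := [set z : 'cV[C]_2 | a * Re (w z) + f * b * Im (w z) = 0].
have Yalg f : real_algebraic (Y f).
  have [p pE] := real_linear_algebraic (\col_j ((a -i* (f * b)) * Q 0 j)).
  exists [:: p]; apply/seteqP; split=> z /= h.
    move=> q; rewrite inE => /eqP ->; rewrite pE -[RHS]h /w.
    under eq_bigr do rewrite mxE -mulrA.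
    rewrite -mulr_sumr [(Q *m z) 0 0]mxE; case: (\sum_j _) => u v /=; ring.
  have := h p; rewrite mem_head => /(_ isT); rewrite pE => {}h; rewrite /Y /= -[RHS]h /w.
  under eq_bigr do rewrite mxE -mulrA.
  rewrite -mulr_sumr [(Q *m z) 0 0]mxE; case: (\sum_j _) => u v /=; ring.
have ME : [set z | cform S H z = 0] = Y 1 `|` Y (-1).
  have e1 z : cform S H z = k * s * ((a * Re (w z) + 1 * b * Im (w z)) * (a * Re (w z) +
      -1 * b * Im (w z))).
    have -> : z = P *m (Q *m z) by rewrite mulKVmx.
    rewrite cE cform_rank1 ea eb /w mulKVmx //; ring.
  apply/seteqP; split=> z /=; rewrite e1.
    by move/eqP; rewrite !mulf_eq0 (negPf k0) (negPf s0) /= => /orP [] /eqP; [left|right].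
  by case=> ->; rewrite !(mul0r, mulr0).
have pt f : f ^+ 2 = 1 -> Y f (P *m vec2 (b -i* (f * a)) 0) /\ ~ Y (- f) (P *m vec2 (b
    -i* (f * a)) 0).
  move=> f2; rewrite /Y /= /w mulKmx // !mxE /=.
  have -> : a * b + f * b * (- (f * a)) = a * b * (1 - f ^+ 2) by ring.
  have -> : a * b + - f * b * (- (f * a)) = a * b * (1 + f ^+ 2) by ring.
  rewrite f2 subrr mulr0; split=> //; apply/eqP; rewrite !mulf_neq0 //.
  by rewrite (_ : 1 + 1 = 2) ?pnatr_eq0.
have [yM|zM] := irr _ _ (Yalg 1) (Yalg (-1)) ME.
- have [|p1 p2] := pt (-1); first by rewrite sqrrN expr1n.
  by apply: p2; rewrite opprK yM ME; right.
- have [|p1 p2] := pt 1; first by rewrite expr1n.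
  by apply: p2; rewrite zM ME; left.
Qed.

End ExistenceNF.

(** * Nonzero derivatives and indefinite forms *)

Section Taylor.
Variable (R : realType).

(** The property holds for constants and variables and is stable under sums and
    products. *)
Lemma meval_taylor n (k : 'I_n) (x : 'I_n -> R) (p : mpoly n R) :
  exists Q : {poly R}, forall t,
    meval (fun i => x i + t * (i == k)%:R) p =
    meval x p + t * meval x (mderiv k p) + t ^+ 2 * Q.[t].
Proof.
pose tay q := exists Q : {poly R}, forall t,
    meval (fun i => x i + t * (i == k)%:R) q =
    meval x q + t * meval x (mderiv k q) + t ^+ 2 * Q.[t].
have tayC c : tay (mpolyC n c).
  by exists 0 => t; rewrite mderivC meval0 !mevalC horner0 !mulr0 !addr0.
have tayM p1 p2 : tay p1 -> tay p2 -> tay (p1 * p2).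
  move=> [Q1 e1] [Q2 e2].
  pose a := meval x p1; pose b := meval x p2.
  pose a' := meval x (mderiv k p1); pose b' := meval x (mderiv k p2).
  exists ((a' * b')%:P + a%:P * Q2 + b%:P * Q1 + 'X * (a'%:P * Q2 + b'%:P * Q1) + 'X^2 *
      Q1 * Q2) => t.
  by rewrite mderivM mevalD !mevalM e1 e2 !hornerE -/a -/b -/a' -/b'; ring.
have tayD p1 p2 : tay p1 -> tay p2 -> tay (p1 + p2).
  move=> [Q1 e1] [Q2 e2]; exists (Q1 + Q2) => t.
  by rewrite mderivD !mevalD e1 e2 hornerD; ring.
have tayX i : tay (mpolyX R (mnm1 i)).
  exists 0 => t; rewrite mderivX mevalZ !mevalXU horner0 mulr0 addr0 mnm1E.
  have [->|ik] := eqVneq i k; last by rewrite mul0r.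
  have -> : mnm_sub (mnm1 k) (mnm1 k) = mnm0.
    by apply/mnmP => j; rewrite mnmBE subnn mnm0E.
  by rewrite mpolyX0 meval1 !mulr1.
have tayXm m : tay (mpolyX R m).
  rewrite mpolyXE_id; elim/big_ind: _ => //; first exact: (tayC 1).
  move=> i _; elim: (m i) => [|e IH]; first by rewrite expr0; exact: (tayC 1).
  by rewrite exprS; apply: tayM.
elim/mpolyind: p => [|c m p _ _ IH]; first exact: (tayC 0).
apply: tayD => //.
have -> : c *: mpolyX R m = mpolyC n c * mpolyX R m by rewrite mul_mpolyC.
exact: tayM.
Qed.

Lemma poly_fun_eq0 (p : {poly R}) : (forall t, p.[t] = 0) -> p = 0.
Proof.
move=> p0; apply/eqP; apply: contraT => pn.
have := @max_poly_roots _ p [seq i%:R | i <- iota 0 (size p)] pn.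
rewrite size_map size_iota ltnn; apply.
  by apply/allP => t _; rewrite /root p0.
rewrite map_inj_uniq ?iota_uniq // => i j /eqP.
by rewrite eqr_nat => /eqP.
Qed.

End Taylor.

(** * An indefinite form is determined by its zeros *)

Section ZeroSet.
Variables (R : realType) (V : Type) (line : V -> V -> R -> V) (f g : V -> R).
Hypothesis f_line : forall x y, exists b, forall t,
  f (line x y t) = f x + t * b + t ^+ 2 * f y.
Hypothesis g_line : forall x y, exists b, forall t,
  g (line x y t) = g x + t * b + t ^+ 2 * g y.

(** Let f x > 0 > f y.  On the line f is t |-> f x + t b + t^2 f y, with two
    distinct roots t1, t2, at which g vanishes too.  Comparing constant and
    leading coefficients, f x = t1 t2 (f y) and g x = t1 t2 (g y), so that
    g x / f x = g y / f y.  Hence this ratio depends neither on x nor on y. *)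
Lemma zero_set_proportional : indefinite f -> (forall z, f z = 0 -> g z = 0) ->
  exists c, forall z, g z = c * f z.
Proof.
move=> [[x0 px] [y0 py]] sub.
have prop x y : 0 < f x -> f y < 0 -> g x * f y = g y * f x.
  move=> fx fy; have [b bE] := f_line x y; have [b' bE'] := g_line x y.
  pose D := b ^+ 2 - 4 * f x * f y; pose r := Num.sqrt D.
  have D0 : 0 < D.
    have fxy : f x * f y < 0 by rewrite pmulr_rlt0.
    by rewrite /D -mulrA; have := sqr_ge0 b; lra.
  have r2 : r ^+ 2 = D by rewrite sqr_sqrtr // ltW.
  have r0 : 0 < r by rewrite sqrtr_gt0.
  pose t1 := (- b + r) / (2 * f y); pose t2 := (- b - r) / (2 * f y).
  have fy0 : f y != 0 by rewrite lt_eqF.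
  have z1 : f x + t1 * b + t1 ^+ 2 * f y = 0.
    rewrite /t1; transitivity ((r ^+ 2 - D) / (4 * f y)); last by rewrite r2 subrr mul0r.
    by rewrite /D; field.
  have z2 : f x + t2 * b + t2 ^+ 2 * f y = 0.
    rewrite /t2; transitivity ((r ^+ 2 - D) / (4 * f y)); last by rewrite r2 subrr mul0r.
    by rewrite /D; field.
  have w1 : g x + t1 * b' + t1 ^+ 2 * g y = 0 by rewrite -bE'; apply: sub; rewrite -[RHS]z1 -bE.
  have w2 : g x + t2 * b' + t2 ^+ 2 * g y = 0 by rewrite -bE'; apply: sub; rewrite -[RHS]z2 -bE.
  have t12 : t2 - t1 != 0.
    rewrite (_ : t2 - t1 = - r / f y); last by rewrite /t1 /t2; field.
    by rewrite mulf_neq0 ?invr_eq0 // oppr_eq0 gt_eqF.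
  have elim u v w : u + t1 * w + t1 ^+ 2 * v = 0 -> u + t2 * w + t2 ^+ 2 * v = 0 -> u = t1 * t2 * v.
    move=> h1 h2; apply: (mulfI t12).
    have : t2 * (u + t1 * w + t1 ^+ 2 * v) - t1 * (u + t2 * w + t2 ^+ 2 * v) = 0 by
        rewrite h1 h2 !mulr0 subrr.
    by move=> h; apply/eqP; rewrite -subr_eq0 -[X in _ == X]h; apply/eqP; ring.
  rewrite (elim _ _ _ w1 w2) (elim _ _ _ z1 z2); ring.
exists (g y0 / f y0) => z; have fy0 : f y0 != 0 by rewrite lt_eqF.
have [zp|zn|z0] := ltrgt0P (f z).
- by apply: (mulIf fy0); rewrite prop //; field.
- have fx0 : f x0 != 0 by rewrite gt_eqF.
  apply: (mulIf fx0); apply: (mulIf fy0); rewrite -[g z * f x0]prop //.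
  rewrite mulrAC prop //; field.
  done.
- by rewrite z0 mulr0 sub.
Qed.

End ZeroSet.

Section Forms.
Variable (R : realType).
Local Notation C := R[i].
Implicit Types (S H : 'M[C]_2).

Lemma cform_line S H z v : exists b : R, forall t : R,
  cform S H (z + t%:C *: v) = cform S H z + t * b + t ^+ 2 * cform S H v.
Proof.
have rc (a : R) : Num.conj a%:C = a%:C :> C by exact: conjc_real.
exists (Re (polar S H z v)) => t.
rewrite /cform (quad_line _ _ _ _ (rc t)) -rmorphXn.
by case: (quad S H z) (polar S H z v) (quad S H v) => [a a'] [b b'] [c c'] /=; ring.
Qed.

Lemma small_factor (g : R) : exists2 s, 0 < s & 0 < 1 + s * g /\ 0 < 1 - s * g.
Proof.
pose s := (1 + `|g|)^-1.
have s0 : 0 < s by rewrite invr_gt0 ltr_pwDl.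
have sg : s * `|g| < 1 by rewrite mulrC ltr_pdivrMr ?ltr_pwDl // mul1r ltrDr.
have g1 : s * g <= s * `|g| by rewrite ler_pM2l // ler_norm.
have g2 : s * - g <= s * `|g| by rewrite ler_pM2l // -normrN ler_norm.
by exists s => //; split; lra.
Qed.

(** In the direction v of the k-th real coordinate the form is t b + t^2 f(v), and
    comparison with [meval_taylor] shows that b is the k-th derivative, hence not
    0.  So the form changes sign at t = 0. *)
Lemma derivative_indefinite S H (rho : mpoly (2 + 2) R) z k :
  (forall z, real_eval rho z = cform S H z) ->
  cform S H z = 0 -> real_eval (mderiv k rho) z != 0 -> indefinite (cform S H).
Proof.
move=> fE fz dn.
pose v : 'cV[C]_2 := match fintype.split k with inl j => delta_mx j 0 | inr j => 'i%C *:
    delta_mx j 0 end.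
have vE t : real_coords (z + t%:C *: v) =1 (fun i => real_coords z i + t * (i == k)%:R).
  move=> i; rewrite /real_coords /v -(inj_eq (can_inj (@splitK 2 2))).
  have eLL (x y : 'I_2) : (inl x == inl y :> 'I_2 + 'I_2) = (x == y) by [].
  have eRR (x y : 'I_2) : (inr x == inr y :> 'I_2 + 'I_2) = (x == y) by [].
  have eLR (x y : 'I_2) : (inl x == inr y :> 'I_2 + 'I_2) = false by [].
  have eRL (x y : 'I_2) : (inr x == inl y :> 'I_2 + 'I_2) = false by [].
  case: (fintype.split k) => j; case: (fintype.split i) => l; rewrite !mxE eqxx andbT;
    rewrite ?(eLL, eRR, eLR, eRL); try case: (l == j) => /=; case: (z l 0) => a b /=; ring.
have [b bE] := cform_line S H z v.
have [Q QE] := meval_taylor k (real_coords z) rho.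
have db : real_eval (mderiv k rho) z = b.
  pose p : {poly R} := 'X * ((real_eval (mderiv k rho) z - b)%:P + 'X * (Q - (cform S H v)%:P)).
  have p0 : p = 0.
    apply: poly_fun_eq0 => t; rewrite !hornerE.
    have := QE t; rewrite -(meval_eq _ (vE t)) -[meval _ rho]/(real_eval rho _) fE bE.
    rewrite -[meval _ rho]/(real_eval rho _) fE -[meval _ (mderiv _ _)]/(real_eval
        (mderiv k rho) z) => e.
    transitivity (cform S H z + t * real_eval (mderiv k rho) z + t ^+ 2 * Q.[t] -
      (cform S H z + t * b + t ^+ 2 * cform S H v)); last by rewrite -e subrr.
    move: (cform S H z) (cform S H v) (real_eval _ _) Q.[t] => x1 x2 x3 x4.
    ring.
  move/eqP: p0; rewrite mulf_eq0 polyX_eq0 /= => /eqP /(congr1 (horner^~ 0)).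
  by rewrite !hornerE => /eqP; rewrite subr_eq0 => /eqP.
rewrite db in dn => {QE}.
have [g gE] : exists g, cform S H v = g by exists (cform S H v).
have [s s0 [p1 p2]] := small_factor g.
have b2 : 0 < b ^+ 2 by rewrite lt0r sqrf_eq0 dn sqr_ge0.
have valE u : cform S H (z + (u * b)%:C *: v) = b ^+ 2 * (u * (1 + u * g)).
  by rewrite bE fz gE; ring.
split.
- by exists (z + (s * b)%:C *: v); rewrite valE; apply: mulr_gt0 => //; apply: mulr_gt0.
- by exists (z + (- s * b)%:C *: v); rewrite valE pmulr_rlt0 // mulNr oppr_lt0 mulr_gt0 // mulNr.
Qed.

Lemma zero_set_determines_form S H S' H' : indefinite (cform S H) ->
  (forall z, cform S H z = 0 -> cform S' H' z = 0) ->
  exists c, forall z, cform S' H' z = c * cform S H z.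
Proof.
by apply: (@zero_set_proportional _ _ (fun x y t => x + t%:C *: y)) => x y;
  exact: cform_line.
Qed.

End Forms.

Section FormsInj.
Variable (R : realType).
Local Notation C := R[i].
Implicit Types (S H : 'M[C]_2).

Lemma cform_eq0 S H : S^T = S -> H ^t* = H -> (forall z, cform S H z = 0) ->
  S = 0 /\ H = 0.
Proof.
move=> Ss Hh f0.
have SE : S = mat2 (S 0 0) (S 0 1) (S 0 1) (S 1 1) by rewrite {1}[S]mat2_eta -{3}Ss mxE.
have conjE i j : Num.conj (H i j) = H j i by rewrite -[in RHS]Hh !mxE.
have HE : H = mat2 (H 0 0) (H 0 1) (Num.conj (H 0 1)) (H 1 1) by rewrite {1}[H]mat2_eta conjE.
have [|||a0 b0 d0 [k0 l0 n0]] := @coord_form_eq0 C (S 0 0) (S 0 1) (S 1 1) (H 0 0) (H 0 1) (H 1 1).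
- exact: conjE.
- exact: conjE.
- move=> z w; have := cformE (vec2 z w) (S 0 0) (S 0 1) (S 0 1) (S 1 1) (H 0 0) (H 0 1)
    (Num.conj (H 0 1)) (H 1 1).
  by rewrite -SE -HE f0 !mxE.
have z2 : mat2 0 0 0 0 = 0 :> 'M[C]_2 by rewrite [RHS]mat2_eta !mxE.
by rewrite SE HE a0 b0 d0 k0 l0 n0 rmorph0 z2.
Qed.

Lemma cformB S H S' H' z : cform (S - S') (H - H') z = cform S H z - cform S' H' z.
Proof. by rewrite /cform quadB; case: (quad S H z) (quad S' H' z) => [a a'] [b b']. Qed.

(** The forms of (S', H') pulled back by P and of (S, H) are proportional, and the
    matrices are determined by the form ([cform_eq0]). *)
Lemma zero_set_congruent S H S' H' P :
  S^T = S -> H ^t* = H -> S'^T = S' -> H' ^t* = H' -> ~ (S' = 0 /\ H' = 0) ->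
  indefinite (cform S H) -> P \in unitmx ->
  (forall z, cform S H z = 0 -> cform S' H' (P *m z) = 0) ->
  congruent S H S' H'.
Proof.
move=> Ss Hh S's H'h n0 ind Pu sub; apply: congruent_sym.
have rc (a : R) : Num.conj a%:C = a%:C :> C by exact: conjc_real.
have [|c cE] := @zero_set_determines_form _ S H (P^T *m S' *m P) (P ^t* *m H' *m P) ind.
  by move=> z fz; rewrite -cform_mulmx; apply: sub.
have [SE HE] : P^T *m S' *m P - c%:C *: S = 0 /\ P ^t* *m H' *m P - c%:C *: H = 0.
  apply: cform_eq0.
  - by rewrite linearB /= linearZ /= !trmx_mul trmxK S's Ss mulmxA.
  - by rewrite linearB /= linearZ /= !trmx_mul map_mxB map_mxZ !map_mxM /= trmxCK H'h Hh rc mulmxA.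
  - by move=> z; rewrite cformB cE cformZ subrr.
move/eqP: SE; rewrite subr_eq0 => /eqP SE; move/eqP: HE; rewrite subr_eq0 => /eqP HE.
exists P, c%:C; split=> //; first by rewrite complex_real.
apply/eqP => c0; apply: n0; rewrite c0 !scale0r in SE HE.
have PTu : P^T \in unitmx by rewrite unitmx_tr.
have Pcu : P ^t* \in unitmx by rewrite map_unitmx.
split; [rewrite -[S'](mulKmx PTu) -[_ *m _](mulmxK Pu)|rewrite -[H'](mulKmx Pcu) -[_ *m
    _](mulmxK Pu)].
  by rewrite -(mulmxA _ _ P) SE mulmx0 mul0mx.
by rewrite -(mulmxA _ _ P) HE mulmx0 mul0mx.
Qed.

Lemma nf_neq0 (t : normal_form R) : ~ (nfS t = 0 /\ nfH t = 0).
Proof.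
by case: t => [A B|A B|A||A|A||] [/matrixP Sz /matrixP Hz]; 
  solve [have /eqP := Hz 0 0; rewrite !mxE oner_eq0 //
        |have /eqP := Sz 0 0; rewrite !mxE oner_eq0 //
        |have /eqP := Hz 0 1; rewrite !mxE /= mulf_eq0 (negPf (neq0Ci _)) invr_eq0 pnatr_eq0 //].
Qed.

End FormsInj.

(** * Germs of biholomorphic maps *)

(** With (u, v) equal to (x, y) or to its conjugate, this is the continuity of one
    of the two terms of a form. *)
Lemma cvg_bilinear (K : numFieldType) (T : Type) (F : set_system T) {FF : Filter F}
    (u v x y : T -> K) (lu lv lx ly a b c d : K) :
  u @ F --> lu -> v @ F --> lv -> x @ F --> lx -> y @ F --> ly ->
  (fun t => u t * (a * x t + b * y t) + v t * (c * x t + d * y t)) @ F -->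
  lu * (a * lx + b * ly) + lv * (c * lx + d * ly).
Proof.
move=> cu cv cx cy.
by apply: cvgD; apply: cvgM => //; apply: cvgD; apply: cvgM => //; exact: cvg_cst.
Qed.

Section Analysis.
Variable (R : realType).
Local Notation C := R[i].
Implicit Types (S H : 'M[C]_2).

Lemma differentiable_mulmx (P : 'M[C]_2) (x : 'cV[C]_2) :
  differentiable (fun z : 'cV[C]_2 => P *m z) x.
Proof.
pose F (j : 'I_2) : 'cV[C]_2 -> 'cV[C]_2 := fun z => z j 0 *: col j P.
rewrite (_ : (fun z => P *m z) = \sum_(j < 2) F j).
  by apply: differentiable_sum => j; apply: differentiableZl; exact: differentiable_coord.
apply/funext => z; rewrite fct_sumE; apply/matrixP => i j.
by rewrite mxE summxE; apply: eq_bigr => k _; rewrite !mxE mulrC ord1.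
Qed.

(** A linear isomorphism is a biholomorphic map of the whole space. *)
Lemma congruent_germ S H S' H' : congruent S H S' H' ->
  germ_biholomorphic [set z | cform S H z = 0] [set z | cform S' H' z = 0].
Proof.
move=> /congruent_cform [P [c [Pu c0 cE]]].
exists setT, setT, (fun z => invmx P *m z), (fun z => P *m z); split.
- split=> //; [exact: openT|exact: openT|exact: mulmx0].
- split=> //.
  + by move=> z _; exact: differentiable_mulmx.
  + by move=> z _; exact: differentiable_mulmx.
  + by apply/seteqP; split=> // z _; exists (P *m z); rewrite ?mulKmx.
  + by move=> z _; rewrite mulKVmx.
- rewrite [in LHS]setIT.
  rewrite [in RHS]setIT.
  apply/seteqP.
  split=> z.
    move=> [y fy <-]; rewrite /mkset in fy *; apply: (mulfI c0).
    by rewrite -cE mulKVmx // fy mulr0.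
  rewrite /mkset => fz; exists (P *m z); first by rewrite /mkset cE fz mulr0.
  by rewrite mulKmx.
Qed.

Lemma linear_cV2_mulmx (f : {linear 'cV[C]_2 -> 'cV[C]_2}) : exists P : 'M[C]_2, forall
    z, f z = P *m z.
Proof.
exists (\matrix_(i, j) f (delta_mx j 0) i 0) => z.
have zE : z = \sum_j z j 0 *: delta_mx j 0.
  by rewrite [LHS]matrix_sum_delta; apply: eq_bigr => j _; rewrite big_ord1.
apply/matrixP => i k; rewrite ord1 {1}zE linear_sum summxE !mxE.
by apply: eq_bigr => j _; rewrite linearZ !mxE mulrC.
Qed.

(** A punctured neighbourhood of 0 in C contains all small positive reals.  Only
    such h are of use below, the cones being invariant under real dilations only. *)
Lemma near0_real (D : set C) : (\forall h \near (0 : C)^', D h) ->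
  exists2 e : R, 0 < e & forall h : R, 0 < h -> h < e -> D h%:C.
Proof.
move=> [e /= e0 eD]; have er : e = (Re e)%:C by rewrite RRe_real // ger0_real // ltW.
exists (Re e); first by rewrite -ltcR -er.
move=> h h0 he; apply: eD => /=.
  by rewrite /ball /= sub0r normrN gtr0_norm ?ltcR // er ltcR.
by rewrite eq_complex /= gt_eqF.
Qed.

Lemma directional_limit (F : 'cV[C]_2 -> 'cV[C]_2) v : differentiable F 0 -> F 0 = 0 ->
  h^-1 *: F (h *: v) @[h --> (0 : C)^'] --> 'd F 0 v.
Proof.
move=> dF F0; rewrite -deriveE //.
have := diff_derivable (v := v) dF; rewrite /derivable /derive.
set g1 := fun h : C => _; set g2 := fun h : C => _.
have -> : g2 = g1; last by [].
by apply/funext => h; rewrite /g1 /g2 /= F0 subr0 addr0.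
Qed.

Lemma near_line (U : set 'cV[C]_2) (v : 'cV[C]_2) : open U -> U 0 ->
  \forall h \near (0 : C)^', U (h *: v).
Proof.
move=> oU U0; have : (h *: v) @[h --> (0 : C)] --> (0 : 'cV[C]_2).
  by rewrite -[X in _ --> X](scale0r v); exact: scalel_continuous.
move=> /(_ U) H; apply: nbhs_dnbhs.
by apply: H; exact: open_nbhs_nbhs.
Qed.

(** Chain rule for G \o F, which is the identity near 0. *)
Lemma left_inverse_diff (U : set 'cV[C]_2) (F G : 'cV[C]_2 -> 'cV[C]_2) v :
  open U -> U 0 -> F 0 = 0 -> (forall z, U z -> G (F z) = z) ->
  differentiable F 0 -> differentiable G (F 0) -> 'd G (F 0) ('d F 0 v) = v.
Proof.
move=> oU U0 F0 GF dF dG; have G0 : G 0 = 0 by rewrite -{1}F0 GF.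
have dGF := differentiable_comp dF dG.
have e : 'd (G \o F) 0 v = 'd G (F 0) ('d F 0 v) := congr1 (fun f => f v) (diff_comp dF dG).
rewrite -e.
have l1 : h^-1 *: (G \o F) (h *: v) @[h --> (0 : C)^'] --> 'd (G \o F) 0 v.
  by apply: directional_limit => //=; rewrite F0.
have l2 : h^-1 *: (G \o F) (h *: v) @[h --> (0 : C)^'] --> v.
  apply: cvg_near_cst; near=> h.
  rewrite /= GF; last by near: h; exact: near_line.
  rewrite scalerA mulVf ?scale1r //.
  by near: h; exact: nbhs_dnbhs_neq.
exact: (cvg_unique (@norm_hausdorff _ _) l1 l2).
Unshelve. all: by end_near.
Qed.

Lemma left_inverse_unitmx (U : set 'cV[C]_2) (F G : 'cV[C]_2 -> 'cV[C]_2) (P : 'M[C]_2) :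
  open U -> U 0 -> F 0 = 0 -> (forall z, U z -> G (F z) = z) ->
  differentiable F 0 -> differentiable G (F 0) ->
  (forall v, 'd F 0 v = P *m v) -> P \in unitmx.
Proof.
move=> oU U0 F0 GF dF dG PE; have [Q QE] := linear_cV2_mulmx ('d G (F 0)).
have QP : Q *m P = 1%:M.
  apply/matrixP => i j.
  have := left_inverse_diff (delta_mx j 0) oU U0 F0 GF dF dG.
  rewrite QE PE mulmxA => /matrixP /(_ i 0).
  by rewrite -colE !mxE eqxx andbT.
by have [] := mulmx1_unit QP.
Qed.

Lemma conj_continuous : continuous (Num.conj : C -> C).
Proof.
move=> x; apply/(@cvgrPdist_lt C C _ (nbhs (x : C)) _) => e e0.
by exists e => //= y /=; rewrite -rmorphB norm_conjC.
Qed.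

Lemma cform_continuous S H : continuous (fun z : 'cV[C]_2 => (cform S H z)%:C).
Proof.
have e : (fun z => (cform S H z)%:C) = fun z : 'cV[C]_2 =>
  let X := (z 0 0 * (S 0 0 * z 0 0 + S 0 1 * z 1 0) + z 1 0 * (S 1 0 * z 0 0 + S 1 1 * z 1 0)) +
    (Num.conj (z 0 0) * (H 0 0 * z 0 0 + H 0 1 * z 1 0) + Num.conj (z 1 0) * (H 1 0 * z 0
        0 + H 1 1 * z 1 0)) in
  (X + Num.conj X) / 2.
  by apply/funext => z /=; rewrite [S]mat2_eta [H]mat2_eta cformE /coord_form ReE -!mat2_eta.
rewrite e => z /=.
have c0 i : (fun y : 'cV[C]_2 => y i 0) @ z --> z i 0 by exact: coord_continuous.
have cc i : (fun y : 'cV[C]_2 => Num.conj (y i 0)) @ z --> Num.conj (z i 0).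
  exact: (cvg_comp _ _ (c0 i) (@conj_continuous _)).
have cX := cvgD (cvg_bilinear (a := S 0 0) (b := S 0 1) (c := S 1 0) (d := S 1 1) (c0 0)
    (c0 1) (c0 0) (c0 1))
  (cvg_bilinear (a := H 0 0) (b := H 0 1) (c := H 1 0) (d := H 1 1) (cc 0) (cc 1) (c0 0) (c0 1)).
have FFz : Filter (nbhs (z : 'cV[C]_2)) by exact: nbhs_filter.
have {}cX := cX FFz FFz FFz.
have cXc := cvg_comp _ _ cX (@conj_continuous _).
exact: cvgM (cvgD cX cXc) (cvg_cst _).
Qed.

Lemma cform_scale S H z (a : R) : cform S H (a%:C *: z) = a ^+ 2 * cform S H z.
Proof.
have rc (b : R) : Num.conj b%:C = b%:C :> C by exact: conjc_real.
rewrite /cform (quad_scale _ _ _ (rc a)) -rmorphXn.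
by case: (quad S H z) => [b b'] /=; rewrite mul0r subr0.
Qed.

(** For small real h > 0 the point h v lies in the cone and in U, so the form
    vanishes at F (h v), hence by homogeneity at F (h v) / h; let h tend to 0. *)
Lemma tangent_cone S H S' H' (U : set 'cV[C]_2) (F : 'cV[C]_2 -> 'cV[C]_2) v :
  open U -> U 0 -> F 0 = 0 -> differentiable F 0 ->
  (forall z, U z -> cform S H z = 0 -> cform S' H' (F z) = 0) ->
  cform S H v = 0 -> cform S' H' ('d F 0 v) = 0.
Proof.
move=> oU U0 F0 dF sub fv.
have l := directional_limit (v := v) dF F0.
have := cvg_comp _ _ l (@cform_continuous S' H' ('d F 0 v)) => {}l.
apply/eqP; apply: contraT => n0.
have nn : (cform S' H' ('d F 0 v))%:C != 0 by rewrite eq_complex /= eqxx andbT.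
have nz : \forall h \near (0 : C)^', (cform S' H' (h^-1 *: F (h *: v)))%:C != 0.
  exact: (cvgr_neq0 _ l nn).
have near0 := near_line v oU U0.
have [e e0 He] := near0_real (filterI nz near0).
have h0 : 0 < e / 2 by rewrite divr_gt0.
have he : e / 2 < e by rewrite ltr_pdivrMr // ltr_pMr // ltr1n.
have [/negP n1 n2] := He _ h0 he; exfalso; apply: n1.
rewrite -fmorphV cform_scale sub ?mulr0 //.
by rewrite cform_scale fv mulr0.
Qed.

(** The derivative of the germ at 0 is invertible and maps one cone into the other. *)
Lemma germ_congruent S H t : S^T = S -> H ^t* = H -> indefinite (cform S H) ->
  germ_biholomorphic [set z | cform S H z = 0] (nf_zeros t) ->
  congruent S H (nfS t) (nfH t).
Proof.
move=> Ss Hh ind [U [V [F [G [[oU oV U0 F0] [hF hG FU GF] FM]]]]].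
have dF : differentiable F 0 by exact: hF.
have dG : differentiable G (F 0) by apply: hG; rewrite -FU; exists 0.
have [P PE] := linear_cV2_mulmx ('d F 0).
have Pu := left_inverse_unitmx oU U0 F0 GF dF dG PE.
apply: (zero_set_congruent Ss Hh (nfS_sym t) (nfH_herm t) (@nf_neq0 _ t) ind Pu) => z fz.
rewrite -PE; apply: (tangent_cone oU U0 F0 dF _ fz) => y Uy fy.
rewrite -nf_rhoE.
by have [] : (nf_zeros t `&` V) (F y) by rewrite -FM; exists y.
Qed.

End Analysis.

(** * The classification of quadratic cones *)

Lemma hermitian_decomposition_cform (R : realType) (rho : mpoly.mpoly (2 + 2) R)
    (S H : 'M[R[i]]_2) : hermitian_decomposition rho S H ->
  [/\ S^T = S, H ^t* = H & forall z, real_eval rho z = cform S H z].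
Proof.
move=> [Ss Hh E]; split.
- by have := Ss; rewrite is_hermitianmxE expr0 scale1r map_mx_id // => /eqP.
- by have := Hh; rewrite is_hermitianmxE expr0 scale1r => /eqP.
- move=> z; have := congr1 (@complex.Re R) (E z); rewrite map_trmx /cform /quad.
  by case: (_ 0 0) (_ 0 0) => [a a'] [b b'].
Qed.

Theorem theorem1p2 (R : realType) (M : set 'cV[R[i]]_2) (pi nu : nat)
    (coneM : quadratic_cone M) (sigM : hermitian_signature M pi nu) :
  exists t : normal_form R,
    [/\ nf_signature t = (pi, nu),
        nf_in_range t,
        germ_biholomorphic M (nf_zeros t)
      & forall t' : normal_form R,
          nf_in_range t' -> germ_biholomorphic M (nf_zeros t') -> t' = t].
Proof.
have [irr _ _] := coneM.
have [[rho [S [H [[_ ME [z [Mz [k dk]]]] hd piE nuE]]]] le] := sigM.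
have [Ss Hh fE] := hermitian_decomposition_cform hd.
have {}ME : M = [set z | cform S H z = 0].
  by rewrite ME; apply/seteqP; split=> y; rewrite /mkset fE.
have ind : indefinite (cform S H).
  by apply: (derivative_indefinite fE _ dk); move: Mz; rewrite ME.
have nonsplit (A e : R) : ~ congruent S H (mat2 A%:C 0 0 0) (mat2 e%:C 0 0 0).
  by move=> c; apply: (split_reducible c ind); rewrite -ME.
have [t [sg rt c]] := exists_normal_form Ss Hh ind piE nuE le nonsplit.
exists t; split=> //.
- have -> : nf_zeros t = [set z | cform (nfS t) (nfH t) z = 0].
    by apply/seteqP; split=> y; rewrite /nf_zeros /mkset nf_rhoE.
  by rewrite ME; exact: congruent_germ.
- move=> t' rt' g; rewrite ME in g; have c' := germ_congruent Ss Hh ind g.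
  exact: nf_congruent_uniq rt' rt (congruent_trans (congruent_sym c') c).
Qed.
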